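(* The set $\mathbf\Delta_\infty=\mathbf\Delta\cap(\mathcal P_{\infty,\infty}\times\mathcal P_{\infty,\infty})$ is arcwise connected; hence it is a connected component of $\mathbf\Delta$.
   Context: $\mathcal H$ is a separable infinite-dimensional complex Hilbert space, $\mathcal B(\mathcal H)$ the bounded operators, $\mathcal P(\mathcal H)=\{P\in\mathcal B(\mathcal H):P=P^2=P^*\}$ with the norm topology. For a closed subspace $\mathcal S$, $P_{\mathcal S}$ denotes the orthogonal projection onto $\mathcal S$; closed subspaces are identified with their projections. Two closed subspaces $\mathcal S,\mathcal T$ have a common complement if there is a closed subspace $\mathcal Z$ with $\mathcal S\cap\mathcal Z=\mathcal T\cap\mathcal Z=\{0\}$ and $\mathcal S+\mathcal Z=\mathcal T+\mathcal Z=\mathcal H$. $\mathbf\Delta=\{(P_{\mathcal S},P_{\mathcal T})\in\mathcal P(\mathcal H)\times\mathcal P(\mathcal H):\mathcal S,\mathcal T\text{ have a common complement}\}$ and $\mathbf\Gamma=(\mathcal P(\mathcal H)\times\mathcal P(\mathcal H))\setminus\mathbf\Delta$. For $0\le i,j\le\infty$ with $i+j=\infty$, $\mathcal P_{i,j}$ denotes the set of projections of rank $i$ and corank ($=\dim$ of null space) $j$; these are the connected components of $\mathcal P(\mathcal H)$. *)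

(* Defs.v *)
From HB Require Import structures.
From mathcomp Require Import all_boot all_order all_algebra.
From mathcomp Require Import complex.
From mathcomp Require Import reals.
Set Implicit Arguments. Unset Strict Implicit. Unset Printing Implicit Defensive.
Import Order.TTheory GRing.Theory Num.Theory.
Local Open Scope ring_scope.

Section Hilbert.
Variable R : realType.
Local Notation C := (R[i]).
Variables (H : lmodType C) (ip : H -> H -> C).

Definition hnorm (x : H) : R := Num.sqrt (complex.Re (ip x x)).

Definition sep_inf_hilbert : Prop :=
  (forall (a : C) (x y z : H), ip (a *: x + y) z = a * ip x z + ip y z) /\
  (forall x y : H, ip y x = conjc (ip x y)) /\
  (forall x : H, 0 <= complex.Re (ip x x)) /\
  (forall x : H, complex.Re (ip x x) = 0 -> x = 0) /\
      (forall u : nat -> H,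
         (forall e : R, 0 < e -> exists N : nat, forall m n : nat,
            (N <= m)%N -> (N <= n)%N -> hnorm (u m - u n) < e) ->
         exists l : H, forall e : R, 0 < e -> exists N : nat, forall n : nat,
            (N <= n)%N -> hnorm (u n - l) < e) /\
      (exists d : nat -> H, forall (x : H) (e : R), 0 < e ->
         exists n : nat, hnorm (x - d n) < e) /\
      (forall s : seq H, exists x : H, forall c : nat -> C,
         x <> \sum_(i < size s) c i *: nth 0 s i).

Definition infdim (S : H -> Prop) : Prop :=
  forall s : seq H, (forall i : nat, (i < size s)%N -> S (nth 0 s i)) ->
  exists x : H, S x /\ forall c : nat -> C,
    x <> \sum_(i < size s) c i *: nth 0 s i.

Definition bounded_op (T : H -> H) : Prop :=
  (forall (a : C) (x y : H), T (a *: x + y) = a *: T x + T y) /\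
  exists M : R, forall x : H, hnorm (T x) <= M * hnorm x.

Definition is_proj (P : H -> H) : Prop :=
  [/\ bounded_op P, (forall x : H, P (P x) = P x) &
      (forall x y : H, ip (P x) y = ip x (P y))].

Definition range (T : H -> H) : H -> Prop := fun x => exists y, x = T y.
Definition kernel (T : H -> H) : H -> Prop := fun x => T x = 0.

Definition proj_inf_inf (P : H -> H) : Prop :=
  is_proj P /\ infdim (range P) /\ infdim (kernel P).

(* S and T have the common complement Z (closed subspaces are identified
   with the ranges of orthogonal projections) *)
Definition is_compl (S Z : H -> Prop) : Prop :=
  (forall x, S x -> Z x -> x = 0) /\
  (forall x, exists s z, S s /\ Z z /\ x = s + z).

Definition Delta (p : (H -> H) * (H -> H)) : Prop :=
  is_proj p.1 /\ is_proj p.2 /\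
  exists Q : H -> H, is_proj Q /\
    is_compl (range p.1) (range Q) /\ is_compl (range p.2) (range Q).

Definition Delta_inf (p : (H -> H) * (H -> H)) : Prop :=
  Delta p /\ proj_inf_inf p.1 /\ proj_inf_inf p.2.

Definition opdist_le (T1 T2 : H -> H) (e : R) : Prop :=
  forall x : H, hnorm (T1 x - T2 x) <= e * hnorm x.

Definition near_pair (e : R) (p q : (H -> H) * (H -> H)) : Prop :=
  opdist_le p.1 q.1 e /\ opdist_le p.2 q.2 e.

Definition norm_open (U : (H -> H) * (H -> H) -> Prop) : Prop :=
  forall p, U p -> exists e : R, 0 < e /\ forall q, near_pair e p q -> U q.

Definition norm_connected (A : (H -> H) * (H -> H) -> Prop) : Prop :=
  ~ exists U V, norm_open U /\ norm_open V /\
     (forall p, A p -> U p \/ V p) /\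
     (exists p, A p /\ U p) /\ (exists p, A p /\ V p) /\
     (forall p, A p -> U p -> V p -> False).

Definition arcwise_connected (A : (H -> H) * (H -> H) -> Prop) : Prop :=
  forall a b, A a -> A b ->
  exists g : R -> (H -> H) * (H -> H),
    [/\ g 0 = a, g 1 = b,
        (forall t : R, 0 <= t <= 1 -> A (g t)) &
        (forall t : R, 0 <= t <= 1 -> forall e : R, 0 < e ->
           exists d : R, 0 < d /\ forall s : R, 0 <= s <= 1 ->
             `|s - t| < d -> near_pair e (g s) (g t))].

Definition is_component (A B : (H -> H) * (H -> H) -> Prop) : Prop :=
  [/\ (exists p, A p), (forall p, A p -> B p), norm_connected A &
      (forall K, norm_connected K -> (forall p, K p -> B p) ->
         (exists p, K p /\ A p) -> forall p, K p -> A p)].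

End Hilbert.

(* Main.v *)
Require Import Defs.
From HB Require Import structures.
From mathcomp Require Import all_boot all_order all_algebra.
From mathcomp Require Import complex reals.
From mathcomp Require Import boolp.
From mathcomp Require Import ring lra.
Set Implicit Arguments. Unset Strict Implicit. Unset Printing Implicit Defensive.
Import Order.TTheory GRing.Theory Num.Theory.
Local Open Scope ring_scope.

(* If [Z] is a common complement of [S] and [T], both are graphs over the
   orthogonal complement [N] of [Z]; scaling the graphs down to zero moves [(S, T)]
   to [(N, N)] through pairs with common complement [Z].  The scaling is done on
   the oblique projections along [Z], whose boundedness follows from the uniform
   boundedness principle, and a formula of Kato turns idempotents into orthogonal
   projections with a Lipschitz control.  It remains to join diagonal pairs
   [(S, S)] and [(T, T)].  Orthogonal subspaces of infinite dimension have the
   graph of a unitary as common complement (within their sum), hence are joined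
   through it; and [S], [T] are linked by a chain [S], [S1], [T1], [T] of
   consecutively orthogonal ones, where [S1] and [T1] are spanned by interleaved
   orthonormal sequences chosen in the complements of [S] and [T].
   Maximality holds because projections at distance less than [1] have the same
   rank and corank. *)

(** * The real inner product underlying the complex one *)

Section HilbertGeometry.
Variable R : realType.
Local Notation C := (R[i]).
Variables (H : lmodType C) (ip : H -> H -> C).
Hypothesis hilb : sep_inf_hilbert ip.
Local Notation hnorm := (hnorm ip).

(** Estimates use the real inner product [re], valued in the ordered field [R]. Real scaling [rs] is
    kept apart from [*:] so that pairing with [re] yields ring identities; [jx], multiplication by
    i, recovers the imaginary part of [ip]. *)
Definition re (x y : H) : R := complex.Re (ip x y).
Definition rs (t : R) (x : H) : H := (t +i* 0)%C *: x.
Definition jx (x : H) : H := (0 +i* 1)%C *: x.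

Lemma ip_lin a x y z : ip (a *: x + y) z = a * ip x z + ip y z.
Proof. by have [h _] := hilb; exact: h. Qed.

Lemma ip_conj x y : ip y x = conjc (ip x y).
Proof. by have [_ [h _]] := hilb; exact: h. Qed.

Lemma re_ge0 x : 0 <= re x x.
Proof. by have [_ [_ [h _]]] := hilb; exact: h. Qed.

Lemma re_eq0 x : re x x = 0 -> x = 0.
Proof. by have [_ [_ [_ [h _]]]] := hilb; exact: h. Qed.

Lemma ipDl x y z : ip (x + y) z = ip x z + ip y z.
Proof. by rewrite -[x in LHS]scale1r ip_lin mul1r. Qed.

Lemma ip0l z : ip 0 z = 0.
Proof. by apply: (addrI (ip 0 z)); rewrite -ipDl !addr0. Qed.

Lemma ipZl a x z : ip (a *: x) z = a * ip x z.
Proof. by rewrite -[a *: x]addr0 ip_lin ip0l addr0. Qed.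

Lemma ip0r z : ip z 0 = 0.
Proof. by rewrite ip_conj ip0l /conjc /= oppr0. Qed.

Lemma ipZr a x z : ip z (a *: x) = conjc a * ip z x.
Proof.
rewrite ip_conj ipZl [ip z x]ip_conj.
case: a (ip x z) => [a b] [c d] /=; simpc; congr (_ +i* _)%C; ring.
Qed.

Lemma ipDr x y z : ip z (x + y) = ip z x + ip z y.
Proof.
rewrite ip_conj ipDl [ip z x]ip_conj [ip z y]ip_conj.
case: (ip x z) (ip y z) => [a b] [c d] /=; simpc; congr (_ +i* _)%C; ring.
Qed.

Lemma reC x y : re x y = re y x.
Proof. by rewrite /re ip_conj; case: (ip y x). Qed.

Lemma reDl x y z : re (x + y) z = re x z + re y z.
Proof. by rewrite /re ipDl; case: (ip x z) (ip y z) => [a b] [c d]. Qed.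

Lemma reZl t x z : re (rs t x) z = t * re x z.
Proof. by rewrite /re ipZl; case: (ip x z) => [a b] /=; ring. Qed.

Lemma reNl x z : re (- x) z = - re x z.
Proof.
by apply: (addrI (re x z)); rewrite -reDl !subrr /re ip0l.
Qed.

Lemma re0l z : re 0 z = 0.
Proof. by rewrite /re ip0l. Qed.

Lemma reDr x y z : re z (x + y) = re z x + re z y.
Proof. by rewrite reC reDl !(reC z). Qed.

Lemma reZr t x z : re z (rs t x) = t * re z x.
Proof. by rewrite reC reZl (reC z). Qed.

Lemma reNr x z : re z (- x) = - re z x.
Proof. by rewrite reC reNl (reC z). Qed.

Lemma re0r z : re z 0 = 0.
Proof. by rewrite reC re0l. Qed.

Definition reE := (reDl, reDr, reZl, reZr, reNl, reNr, re0l, re0r).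

Lemma re_ext x y : (forall z, re x z = re y z) -> x = y.
Proof.
move=> h; apply/eqP; rewrite -subr_eq0; apply/eqP/re_eq0.
by rewrite reDl reNl h subrr.
Qed.

Lemma re_jr x y : re x (jx y) = complex.Im (ip x y).
Proof. by rewrite /re ipZr; case: (ip x y) => [a b] /=; ring. Qed.

Lemma ip_re x y : ip x y = (re x y +i* re x (jx y))%C.
Proof. by rewrite re_jr /re; case: (ip x y). Qed.

Lemma hnorm_ge0 x : 0 <= hnorm x.
Proof. exact: sqrtr_ge0. Qed.

Lemma hnorm2 x : hnorm x ^+ 2 = re x x.
Proof. by rewrite sqr_sqrtr ?re_ge0. Qed.

Lemma hnorm_le x c : 0 <= c -> (hnorm x <= c) = (re x x <= c ^+ 2).
Proof. by move=> c0; rewrite -hnorm2 ler_pXn2r ?nnegrE ?hnorm_ge0. Qed.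

Lemma hnorm_sqr_le x y : (hnorm x <= hnorm y) = (re x x <= re y y).
Proof. by rewrite hnorm_le ?hnorm_ge0 // hnorm2. Qed.

Lemma hnorm0 : hnorm 0 = 0.
Proof. by rewrite /Defs.hnorm ip0l sqrtr0. Qed.

Lemma hnorm_le0 x : hnorm x <= 0 -> x = 0.
Proof.
move=> h; have /eqP e : hnorm x == 0 by rewrite eq_le h hnorm_ge0.
by apply: re_eq0; rewrite -hnorm2 e expr0n.
Qed.

Lemma cauchy_schwarz_sqr x y : re x y ^+ 2 <= re x x * re y y.
Proof.
have [y0|yn] := eqVneq (re y y) 0.
  by rewrite (re_eq0 y0) !re0r mulr0 expr0n.
have yp : 0 < re y y by rewrite lt_neqAle eq_sym yn re_ge0.
have h : 0 <= re y y * (re x x * re y y - re x y ^+ 2).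
  (* The squared norm of this vector is [re y y] times the defect in the inequality. *)
  have := re_ge0 (rs (re y y) x - rs (re x y) y).
  by rewrite !reE (reC y x); lra.
by rewrite pmulr_rge0 // subr_ge0 in h.
Qed.

Lemma cauchy_schwarz x y : `|re x y| <= hnorm x * hnorm y.
Proof.
rewrite -(@ler_pXn2r _ 2) ?nnegrE ?mulr_ge0 ?hnorm_ge0 //.
by rewrite exprMn !hnorm2 real_normK ?num_real // cauchy_schwarz_sqr.
Qed.

Lemma re_le x y : re x y <= hnorm x * hnorm y.
Proof. exact: le_trans (ler_norm _) (cauchy_schwarz _ _). Qed.

Lemma hnormD x y : hnorm (x + y) <= hnorm x + hnorm y.
Proof.
rewrite hnorm_le ?addr_ge0 ?hnorm_ge0 // !reE (reC y x) sqrrD !hnorm2.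
have := re_le x y; lra.
Qed.

Lemma hnormN x : hnorm (- x) = hnorm x.
Proof. by apply/eqP; rewrite eq_le !hnorm_sqr_le !reE opprK lexx. Qed.

Lemma hnormB x y : hnorm (x - y) <= hnorm x + hnorm y.
Proof. by rewrite -(hnormN y) hnormD. Qed.

Lemma hnorm_sym x y : hnorm (x - y) = hnorm (y - x).
Proof. by rewrite -hnormN opprB. Qed.

Lemma hnorm_tri y x z : hnorm (x - z) <= hnorm (x - y) + hnorm (y - z).
Proof. by rewrite -[x - z](subrKA y) hnormD. Qed.

Lemma hnorm_rs t x : hnorm (rs t x) = `|t| * hnorm x.
Proof.
apply/eqP; rewrite -(@eqrXn2 _ 2) ?mulr_ge0 ?hnorm_ge0 //.
by rewrite exprMn !hnorm2 !reE real_normK ?num_real // mulrA expr2.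
Qed.

Lemma hnorm_dual x c : 0 <= c -> (forall z, re x z <= c * hnorm z) -> hnorm x <= c.
Proof.
move=> c0 h; have [->//|xn] := eqVneq (hnorm x) 0.
have xp : 0 < hnorm x by rewrite lt_neqAle eq_sym xn hnorm_ge0.
by have := h x; rewrite -hnorm2 expr2 ler_pM2r.
Qed.


(* Pairing with an arbitrary vector turns an identity between real linear
   combinations of vectors into a ring identity. *)
Ltac hring := apply: re_ext => ?; rewrite ?reE; ring.

(** * Completeness: contractions, coercive operators, uniform boundedness *)

(** This replaces limits of geometric sequences. By Bernoulli's inequality a positive [a] would
    satisfy [a * (1 + n%:R * (1 - q)) <= c] for every [n], against the Archimedean property. *)
Lemma geometric_le0 (q c a : R) :
  0 <= q < 1 -> (forall n, a <= c * q ^+ n) -> a <= 0.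
Proof.
move=> /andP[q0 q1] h; rewrite leNgt; apply/negP => a0.
have bern n : q ^+ n * (1 + n%:R * (1 - q)) <= 1.
  elim: n => [|n IH]; first by rewrite expr0; lra.
  apply: le_trans IH; rewrite exprS -natr1.
  have qn : 0 <= q ^+ n by rewrite exprn_ge0.
  have n0 : 0 <= n%:R :> R by rewrite ler0n.
  set N := n%:R in n0 *; set Q := q ^+ n in qn *.
  (* The two sides of the induction step differ by exactly this term. *)
  have : 0 <= Q * ((N + 1) * (1 - q) ^+ 2) by rewrite mulr_ge0 // mulr_ge0 ?sqr_ge0 //; lra.
  lra.
have c0 : 0 < c by have := h 0%N; rewrite expr0; lra.
have d0 : 0 < a * (1 - q) by rewrite mulr_gt0 // subr_gt0.
have := archi_boundP (ltW (divr_gt0 c0 d0)); rewrite ltr_pdivrMr //.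
set n := Num.bound _; have := h n; have := bern n.
have n0 : 0 <= n%:R :> R by rewrite ler0n.
have qn : 0 <= q ^+ n by rewrite exprn_ge0.
set N := n%:R in n0 *; set Q := q ^+ n in qn *.
move=> h1 h2 h3.
have h4 : a * (1 + N * (1 - q)) <= c * Q * (1 + N * (1 - q)).
  by apply: ler_wpM2r => //; rewrite addr_ge0 // mulr_ge0 //; lra.
have h5 : c * (Q * (1 + N * (1 - q))) <= c by rewrite ger_pMr.
lra.
Qed.

Definition tends (u : nat -> H) (l : H) : Prop :=
  forall e : R, 0 < e -> exists N, forall n, (N <= n)%N -> hnorm (u n - l) < e.

Lemma complete (u : nat -> H) :
  (forall e : R, 0 < e -> exists N, forall m n,
     (N <= m)%N -> (N <= n)%N -> hnorm (u m - u n) < e) ->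
  exists l, tends u l.
Proof. by have [_ [_ [_ [_ [h _]]]]] := hilb; exact: h. Qed.

Lemma geometric_tends (u : nat -> H) (c q : R) : 0 <= c -> 0 <= q < 1 ->
  (forall n, hnorm (u n.+1 - u n) <= c * q ^+ n) ->
  exists l, forall n, hnorm (u n - l) <= c / (1 - q) * q ^+ n.
Proof.
move=> c0 q01 hu; have /andP[q0 q1] := q01.
have d0 : 0 < 1 - q by rewrite subr_gt0.
set D := c / (1 - q); have D0 : 0 <= D by rewrite divr_ge0 // ltW.
have cD : c = D * (1 - q) by rewrite /D divfK // gt_eqF.
have q_ge0 n : 0 <= q ^+ n by rewrite exprn_ge0.
(* Keeping the factor [1 - q ^+ k] of the finite geometric sum lets the induction on [k] close. *)
have tail n k : hnorm (u (n + k)%N - u n) <= D * q ^+ n * (1 - q ^+ k).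
  elim: k => [|k IH]; first by rewrite addn0 subrr hnorm0 expr0 subrr mulr0.
  apply: le_trans (hnorm_tri (u (n + k)%N) _ _) _.
  rewrite addnS; apply: le_trans (lerD (hu _) IH) _.
  by rewrite cD exprD exprS; lra.
have {}tail n m : (n <= m)%N -> hnorm (u m - u n) <= D * q ^+ n.
  move=> nm; rewrite -(subnKC nm); apply: le_trans (tail _ _) _.
  by apply: ler_piMr; [exact: mulr_ge0|have := q_ge0 (m - n)%N; lra].
have small e : 0 < e -> exists N, D * q ^+ N < e.
  move=> e0; apply: contrapT => /forallNP h.
  have : e <= 0 by apply: (geometric_le0 (c := D) q01) => n; rewrite leNgt; apply/negP/h.
  lra.
have [|l hl] := @complete u.
  move=> e e0; have [N hN] : exists N, D * q ^+ N < e / 2 by apply: small; lra.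
  exists N => m n hm hn; have h1 := tail _ _ hm; have h2 := tail _ _ hn.
  have := hnorm_tri (u N) (u m) (u n); rewrite (hnorm_sym (u N) (u n)); lra.
exists l => n; apply/ler_addgt0Pr => e e0; have [N hN] := hl _ e0.
have h1 := hN _ (leq_maxl N n); have h2 := tail _ _ (leq_maxr N n).
have := hnorm_tri (u (maxn N n)) (u n) l; rewrite (hnorm_sym (u n) (u _)); lra.
Qed.

Definition lin (T : H -> H) : Prop :=
  forall (a : C) (x y : H), T (a *: x + y) = a *: T x + T y.
Definition bnd (T : H -> H) (M : R) : Prop :=
  forall x, hnorm (T x) <= M * hnorm x.
Definition adj (T T' : H -> H) : Prop := forall x y, re (T x) y = re x (T' y).

Section Linear.
Variables (T : H -> H) (hT : lin T).

Lemma linD x y : T (x + y) = T x + T y.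
Proof. by rewrite -[x in LHS]scale1r hT scale1r. Qed.

Lemma lin0 : T 0 = 0.
Proof. by apply: (addrI (T 0)); rewrite -linD !addr0. Qed.

Lemma linZ a x : T (a *: x) = a *: T x.
Proof. by rewrite -[a *: x]addr0 hT lin0 addr0. Qed.

Lemma linR t x : T (rs t x) = rs t (T x).
Proof. exact: linZ. Qed.

Lemma linN x : T (- x) = - T x.
Proof. by rewrite -scaleN1r linZ scaleN1r. Qed.

Lemma linB x y : T (x - y) = T x - T y.
Proof. by rewrite linD linN. Qed.

Lemma lin_sum (I : Type) (r : seq I) (F : I -> H) :
  T (\sum_(i <- r) F i) = \sum_(i <- r) T (F i).
Proof. by apply: (big_morph T linD lin0). Qed.

End Linear.

Lemma contraction_solve A q y : lin A -> 0 <= q < 1 -> bnd A q ->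
  exists x, x = y + A x.
Proof.
move=> lA q01 bA; have /andP[q0 q1] := q01.
pose u n := iter n (fun x => y + A x) 0.
have [|l hl] := geometric_tends (u := u) (hnorm_ge0 y) q01.
  elim=> [|n IH]; first by rewrite /u /= lin0 // addr0 subr0 expr0 mulr1.
  have -> : u n.+2 - u n.+1 = A (u n.+1 - u n).
    by rewrite linB // [u n.+2]/= [u n.+1 in X in _ - X]/=; hring.
  apply: le_trans (bA _) _; rewrite exprS; nra.
exists l; apply/eqP; rewrite -subr_eq0; apply/eqP/hnorm_le0.
(* The residual [l - (y + A l)] is independent of [n] and has norm at most [2 D q^n], so it
   vanishes. *)
set D := hnorm y / (1 - q) in hl; apply: (geometric_le0 (c := D + D) q01) => n.
have h1 := hl n.+1; have h2 := hl n.
have -> : l - (y + A l) = (l - u n.+1) + A (u n - l).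
  by rewrite linB // [u n.+1]/=; hring.
apply: le_trans (hnormD _ _) _; rewrite hnorm_sym.
have := bA (u n - l); have := hnorm_ge0 (u n - l).
have qn : 0 <= D * q ^+ n by apply: le_trans h2; exact: hnorm_ge0.
rewrite exprS in h1; nra.
Qed.

(** Solving [B x = y] means finding a fixed point of [x - a B x + a y]. With [m] a bound of [B],
    [r = c / m] and [a = r / m], one gets [|x - a B x|^2 <= (1 - r^2) |x|^2], a contraction.
    Coercivity also bounds the inverse. *)
Lemma lax_milgram B M c : lin B -> bnd B M -> 0 < c ->
  (forall x, c * re x x <= re (B x) x) ->
  exists K, [/\ cancel K B, cancel B K, lin K & bnd K (1 / c)].
Proof.
move=> lB bB c0 coer.
have inj x y : B x = B y -> x = y.
  move=> e; apply/eqP; rewrite -subr_eq0; apply/eqP/re_eq0.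
  have := coer (x - y); rewrite linB // e subrr re0l.
  have := re_ge0 (x - y); nra.
have low x : hnorm x <= 1 / c * hnorm (B x).
  have h1 := coer x; have h2 := re_le (B x) x; rewrite -hnorm2 in h1.
  have n0 := hnorm_ge0 x; rewrite mulrC mulrA mulr1 ler_pdivlMr //.
  have [->|xn] := eqVneq (hnorm x) 0; first by rewrite mul0r hnorm_ge0.
  have xp : 0 < hnorm x by rewrite lt_neqAle eq_sym xn n0.
  by rewrite -(ler_pM2r xp); lra.
(* Adding [c] makes [m] positive and ensures [c / m <= 1]. *)
pose m := `|M| + c; have m0 : 0 < m by rewrite ltr_wpDl.
have bm x : re (B x) (B x) <= m ^+ 2 * re x x.
  have h := bB x; have n0 := hnorm_ge0 x.
  rewrite -!hnorm2 -exprMn ler_pXn2r ?nnegrE ?hnorm_ge0 ?mulr_ge0 ?(ltW m0) //.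
  apply: le_trans h _; apply: ler_wpM2r => //; apply: le_trans (ler_norm M) _.
  by rewrite lerDl ltW.
pose r := c / m; have cm : c = r * m by rewrite /r divfK // gt_eqF.
have r0 : 0 < r by rewrite divr_gt0.
have r1 : r <= 1 by rewrite ler_pdivrMr // mul1r lerDr.
pose a := r / m; have am : a * m = r by rewrite /a divfK // gt_eqF.
have a0 : 0 < a by rewrite divr_gt0.
pose A x := x - rs a (B x).
have lA : lin A.
  by move=> b x y; rewrite /A lB /rs scalerDr scalerBr !scalerA (mulrC b) opprD addrACA.
(* The square of this constant is [1 - r^2] plus [(r^2 / 2)^2], which avoids a square root. *)
have bA : bnd A (1 - r ^+ 2 / 2).
  move=> x; rewrite hnorm_le; last by rewrite mulr_ge0 ?hnorm_ge0 //; nra.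
  rewrite exprMn hnorm2 /A !reE (reC x (B x)).
  have h1 := coer x; have h2 := bm x; have x0 := re_ge0 x.
  have h3 : a * c * re x x <= a * re (B x) x by rewrite -mulrA ler_wpM2l // ltW.
  have h4 : a * (a * re (B x) (B x)) <= r ^+ 2 * re x x.
    have := ler_wpM2l (sqr_ge0 a) h2.
    have -> : a ^+ 2 * (m ^+ 2 * re x x) = (a * m) ^+ 2 * re x x by ring.
    by rewrite am; lra.
  have ac : a * c = r ^+ 2 by rewrite cm mulrCA am expr2.
  rewrite ac in h3; have h5 : 0 <= (r ^+ 2 / 2) ^+ 2 * re x x by rewrite mulr_ge0 ?sqr_ge0.
  lra.
have q01 : 0 <= 1 - r ^+ 2 / 2 < 1 by apply/andP; split; nra.
have surj y : exists x, B x = y.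
  have [x hx] := contraction_solve (rs a y) lA q01 bA; exists x.
  have e : rs a (B x) = rs a y.
    by rewrite -[rs a (B x)](subKr x) {1}hx /A; hring.
  apply: re_ext => z; apply: (mulfI (lt0r_neq0 a0)).
  by rewrite -!reZl e.
have [K hK] := choice surj.
exists K; split=> //.
- by move=> x; apply: inj; rewrite hK.
- by move=> b x y; apply: inj; rewrite lB !hK.
- by move=> x; rewrite -{2}(hK x) low.
Qed.

(* A gliding hump: moving from [x n] by [3^-n] along [+- y n] makes
   [re (x n.+1) (y n)] as large as [(4/3)^n], and the later moves,
   of total size [3^-n / 2], undo at most half of it. *)
Lemma uniform_boundedness (y : nat -> H) : (forall n, 4 ^+ n <= hnorm (y n)) ->
  (forall x, exists M, forall n, `|re x (y n)| <= M) -> False.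
Proof.
move=> hy ptw; pose q : R := 3^-1.
have q01 : 0 <= q < 1 by rewrite /q; lra.
pose stp n x := rs ((if 0 <= re x (y n) then 1 else -1) * q ^+ n / hnorm (y n)) (y n).
pose fix u n := if n is m.+1 then u m + stp m (u m) else 0.
have y0 n : 0 < hnorm (y n) by apply: lt_le_trans (hy n); rewrite exprn_gt0.
have q0 n : 0 < q ^+ n by rewrite exprn_gt0 // /q; lra.
have [|l hl] := geometric_tends (u := u) (c := 1) ler01 q01.
  move=> n /=; have -> : u n + stp n (u n) - u n = stp n (u n) by hring.
  rewrite hnorm_rs normrM normfV (ger0_norm (ltW (y0 n))) divfK ?gt_eqF //.
  by rewrite normrM (ger0_norm (ltW (q0 n))); case: ifP; rewrite ?normrN normr1.
have big n : q ^+ n * hnorm (y n) <= `|re (u n.+1) (y n)|.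
  rewrite /= /stp !reE -hnorm2.
  have -> (s : R) : s * q ^+ n / hnorm (y n) * hnorm (y n) ^+ 2 = s * (q ^+ n * hnorm (y n)).
    by field; rewrite gt_eqF.
  have h : 0 <= q ^+ n * hnorm (y n) by rewrite mulr_ge0 // ltW.
  case: ifP => [h0|/negbT]; first by rewrite ger0_norm; lra.
  by rewrite -ltNge => h0; rewrite ler0_norm; lra.
have [M hM] := ptw l.
(* The growth [(4/3)^n <= 2 M] is put as [1 <= 2 M (3/4)^n], to which [geometric_le0] applies. *)
have : (1 : R) <= 0.
  apply: (@geometric_le0 (3 / 4) (2 * M)); first by lra.
  move=> n; have h1 := big n; have h2 := hM n.
  have h3 := cauchy_schwarz (u n.+1 - l) (y n); rewrite reDl reNl in h3.
  have h4 : hnorm (u n.+1 - l) * hnorm (y n) <= q ^+ n / 2 * hnorm (y n).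
    apply: ler_wpM2r; first exact: hnorm_ge0.
    apply: le_trans (hl n.+1) _; rewrite exprS mulrA.
    have -> : 1 - q = 2 / 3 by rewrite /q; lra.
    have -> : 1 / (2 / 3) * q = 2^-1 by rewrite /q; field.
    by rewrite mulrC.
  have h5 : `|re (u n.+1) (y n)| <= `|re (u n.+1) (y n) - re l (y n)| + `|re l (y n)|.
    by apply: le_trans (ler_normD _ _); rewrite subrK.
  have h6 : q ^+ n * hnorm (y n) <= 2 * M by lra.
  have h7 : 1 <= (3 / 4) ^+ n * (q ^+ n * hnorm (y n)) :> R.
    rewrite mulrA -exprMn; have -> : 3 / 4 * q = 4^-1 by rewrite /q; field.
    by rewrite exprVn mulrC ler_pdivlMr ?exprn_gt0 // mul1r.
  apply: le_trans h7 _; rewrite mulrC; apply: ler_wpM2r => //.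
  by rewrite exprn_ge0 //; lra.
by lra.
Qed.

(** * Paths of projections with a fixed complement *)

Lemma adj_sym T T' : adj T T' -> adj T' T.
Proof. by move=> h x y; rewrite reC -h reC. Qed.

Lemma adj_bnd T T' M : 0 <= M -> adj T T' -> bnd T M -> bnd T' M.
Proof.
move=> M0 h b y; apply: hnorm_dual => [|z]; first by rewrite mulr_ge0 ?hnorm_ge0.
rewrite reC -h; apply: le_trans (re_le _ _) _.
by rewrite mulrAC; apply: ler_wpM2r; rewrite ?hnorm_ge0.
Qed.

Lemma bnd_weak T M M' : M <= M' -> bnd T M -> bnd T M'.
Proof.
by move=> h b x; apply: le_trans (b x) _; apply: ler_wpM2r; rewrite ?hnorm_ge0.
Qed.

Section Projection.
Variables (P : H -> H) (hP : is_proj ip P).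

Lemma proj_lin : lin P.
Proof. by have [[]] := hP. Qed.

Lemma proj_idem x : P (P x) = P x.
Proof. by have [] := hP. Qed.

Lemma proj_adj : adj P P.
Proof. by move=> x y; case: hP => _ _ h; rewrite /re h. Qed.

Lemma proj_pyth x : re x x = re (P x) (P x) + re (x - P x) (x - P x).
Proof.
rewrite !reE (reC (P x) x) -!proj_adj proj_idem; ring.
Qed.

Lemma proj_le x : hnorm (P x) <= hnorm x.
Proof. by rewrite hnorm_sqr_le (proj_pyth x) lerDl re_ge0. Qed.

Lemma rangeP x : range P x <-> P x = x.
Proof. by split=> [[y ->]|<-]; [rewrite proj_idem|exists x]. Qed.

End Projection.

(** Self-adjointness for [re] suffices: a linear [P] commutes with [jx], so the imaginary parts
    agree as well. *)
Lemma proj_intro P M : lin P -> bnd P M -> (forall x, P (P x) = P x) ->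
  adj P P -> is_proj ip P.
Proof.
move=> lP bP iP aP; split=> //; first by split=> //; exists M.
by move=> x y; rewrite !ip_re !aP linZ.
Qed.

Definition compl_op (P : H -> H) (x : H) : H := x - P x.

Lemma compl_op_proj P : is_proj ip P -> is_proj ip (compl_op P).
Proof.
move=> hP; have lP := proj_lin hP.
apply: (@proj_intro _ 1) => [a x y|x|x|x y]; rewrite /compl_op.
- by rewrite lP scalerBr opprD addrACA.
- by rewrite mul1r hnorm_sqr_le (proj_pyth hP x) lerDr re_ge0.
- by rewrite linB // proj_idem // subrr subr0.
- by rewrite !reE (proj_adj hP).
Qed.

Lemma kernel_compl_op P x : is_proj ip P ->
  kernel P x <-> range (compl_op P) x.
Proof.
move=> hP; rewrite (rangeP (compl_op_proj hP)) /compl_op /kernel.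
split=> [Px|/eqP]; first by rewrite Px subr0.
by rewrite -subr_eq0 addrAC subrr sub0r oppr_eq0 => /eqP.
Qed.

(** Otherwise the kernel of [Q] contains vectors [y n] of norm at least [4 ^+ n] with [P (y n)] in
    the unit ball. For [x = s + z] along the decomposition, [re x (y n) = re s (P (y n))] stays
    below [hnorm s], contradicting uniform boundedness. *)
Lemma compl_bounded_below P Q : is_proj ip P -> is_proj ip Q ->
  is_compl (range P) (range Q) ->
  exists c, 0 < c /\ forall y, Q y = 0 -> c * hnorm y <= hnorm (P y).
Proof.
move=> hP hQ [_ dec]; apply: contrapT => /forallNP h.
have bad n : exists y, Q y = 0 /\ 4 ^+ n <= hnorm y /\ hnorm (P y) <= 1.
  have c0 : 0 < (4 ^+ n)^-1 :> R by rewrite invr_gt0 exprn_gt0.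
  have := h ((4 ^+ n)^-1); rewrite not_andE => -[//|/existsNP[y /not_implyP[Qy]]].
  move/negP; rewrite -ltNge => hy.
  have y0 : 0 < hnorm y.
    by have := hnorm_ge0 (P y) => a; have b := le_lt_trans a hy; rewrite pmulr_rgt0 in b.
  exists (rs (4 ^+ n / hnorm y) y); split.
    by rewrite (linR (proj_lin hQ)) Qy /rs scaler0.
  have k0 : 0 <= 4 ^+ n / hnorm y by rewrite divr_ge0 ?exprn_ge0 ?ltW.
  rewrite linR ?hnorm_rs ?ger0_norm //; last exact: proj_lin.
  rewrite divfK ?gt_eqF //; split=> //; rewrite mulrAC ler_pdivrMr // mul1r.
  by move: hy; rewrite mulrC ltr_pdivlMr ?exprn_gt0 // mulrC => /ltW.
have [y hy] := choice bad.
apply: (@uniform_boundedness y) => [n|x]; first by have [_ []] := hy n.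
have [s [z [/(rangeP hP) Ps [/(rangeP hQ) Qz ->]]]] := dec x.
exists (hnorm s) => n; have [Qy [_ Py]] := hy n.
rewrite reDl -Qz (proj_adj hQ) Qy re0r addr0 -Ps (proj_adj hP).
by apply: le_trans (cauchy_schwarz _ _) _; rewrite Ps ler_piMr ?hnorm_ge0.
Qed.

(* The oblique projection onto [range P] along [range Q] is [P K G], with
   [G = 1 - Q] and [K] the inverse of the coercive operator [G P G + Q]. *)
Lemma oblique_projection P Q : is_proj ip P -> is_proj ip Q ->
  is_compl (range P) (range Q) ->
  exists F F' M, [/\ lin F, bnd F M, adj F F',
    (forall x, P (F x) = F x) /\ (forall x, P x = x -> F x = x) &
    (forall x, Q x = x -> F x = 0) /\ (forall x, compl_op Q (F x) = compl_op Q x)].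
Proof.
move=> hP hQ hc; have [c [c0 low]] := compl_bounded_below hP hQ hc.
have hG := compl_op_proj hQ; set G := compl_op Q in hG *.
have lP := proj_lin hP; have lQ := proj_lin hQ; have lG := proj_lin hG.
have QG x : Q (G x) = 0 by rewrite /G /compl_op linB // proj_idem // subrr.
have GQ x : G (Q x) = 0 by rewrite /G /compl_op proj_idem // subrr.
have split_x x : G x + Q x = x by rewrite /G /compl_op subrK.
pose B x := G (P (G x)) + Q x.
have lB : lin B by move=> a x y; rewrite /B lG lP lG lQ !scalerDr addrACA.
have bB : bnd B 2.
  move=> x; apply: le_trans (hnormD _ _) _.
  have h1 := proj_le hG (P (G x)); have h2 := proj_le hP (G x).
  have h3 := proj_le hG x; have h4 := proj_le hQ x; lra.
(* Here [re (B x) x = |P G x|^2 + |Q x|^2], to be compared with [|x|^2 = |G x|^2 + |Q x|^2]. *)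
pose k := Num.min (c ^+ 2) 1.
have k0 : 0 < k by rewrite lt_min exprn_gt0 //=.
have coer x : k * re x x <= re (B x) x.
  have e1 : re (G (P (G x))) x = re (P (G x)) (P (G x)).
    by rewrite (proj_adj hG) -[in LHS](proj_idem hP) (proj_adj hP).
  have e2 : re (Q x) x = re (Q x) (Q x).
    by rewrite -[in LHS](proj_idem hQ) (proj_adj hQ).
  have h1 : c ^+ 2 * re (G x) (G x) <= re (P (G x)) (P (G x)).
    rewrite -!hnorm2 -exprMn ler_pXn2r ?nnegrE ?hnorm_ge0 ?mulr_ge0 ?(ltW c0) ?hnorm_ge0 //.
    exact: low.
  rewrite [re (B x) x]reDl e1 e2 (proj_pyth hQ x) -/(compl_op Q x) -/(G x).
  have kc : k <= c ^+ 2 by rewrite ge_min lexx.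
  have k1 : k <= 1 by rewrite ge_min lexx orbT.
  have := ler_wpM2r (re_ge0 (G x)) kc; have := ler_wpM2r (re_ge0 (Q x)) k1; lra.
have aB : adj B B.
  move=> x y; rewrite [LHS]reDl [RHS]reDr (proj_adj hG) (proj_adj hP) (proj_adj hG).
  by rewrite (proj_adj hQ).
have [K [BK KB lK bK]] := lax_milgram lB bB k0 coer.
have aK : adj K K by move=> x y; rewrite -[in LHS](BK y) -aB BK.
have QK x : Q (K x) = Q x by rewrite -[in RHS](BK x) /B linD // QG add0r proj_idem.
have GPGK x : G (P (G (K x))) = G x.
  by rewrite -[in RHS](BK x) /B linD // GQ addr0 proj_idem.
have GKG x : G (K (G x)) = K (G x) by rewrite -[RHS]split_x QK QG addr0.
pose F x := P (K (G x)).
have GF x : G (F x) = G x by rewrite /F -GKG GPGK proj_idem.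
exists F, (fun x => G (K (P x))), (1 / k); split=> //.
- by move=> a x y; rewrite /F lG lK lP.
- move=> x; apply: le_trans (proj_le hP _) _; apply: le_trans (bK _) _.
  by rewrite ler_wpM2l ?proj_le // divr_ge0 // ltW.
- by move=> x y; rewrite /F (proj_adj hP) aK (proj_adj hG).
- split=> [x|x Px]; first by rewrite /F proj_idem.
  (* [x - F x] lies in [range P] and, being killed by [G], in [range Q]; these meet only in zero. *)
  apply/eqP; rewrite eq_sym -subr_eq0; apply/eqP; apply: hc.1.
    by apply/(rangeP hP); rewrite linB // Px /F proj_idem.
  apply/(rangeP hQ); rewrite -[RHS]split_x [G _]linB // GF subrr add0r.
  by rewrite linB.
- split=> // x Qx; rewrite /F /G /compl_op Qx subrr lin0 //; exact: lin0.
Qed.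

Lemma re_scale a x y : re x (a *: y) = re (conjc a *: x) y.
Proof. by rewrite /re ipZr ipZl. Qed.

Lemma adj_lin T T' : lin T -> adj T T' -> lin T'.
Proof.
move=> lT h a x y; apply: re_ext => z.
by rewrite reC -h reDr re_scale -linZ // !h -re_scale -reDr reC.
Qed.

(* Kato: the orthogonal projection with the range of the idempotent [F] is
   [F F' N^-1] where [N = 1 - (F - F')^2] commutes with [F] and [F']. *)
Lemma idempotent_range_proj F F' M : lin F -> bnd F M -> adj F F' ->
  (forall x, F (F x) = F x) ->
  exists P, [/\ is_proj ip P, forall x, F (P x) = P x & forall x, P (F x) = F x].
Proof.
move=> lF bF aF iF.
have lF' := adj_lin lF aF; have aF' := adj_sym aF.
have {}bF : bnd F `|M| by apply: bnd_weak bF; exact: ler_norm.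
have bF' := adj_bnd (normr_ge0 M) aF bF.
have iF' x : F' (F' x) = F' x by apply: re_ext => z; rewrite !aF' iF.
pose N x := x - F x - F' x + F (F' x) + F' (F x).
have lN : lin N.
  move=> a x y; rewrite /N !(lF, lF') !scalerDr !scalerN; hring.
have bN : bnd N (1 + `|M| + `|M| + `|M| * `|M| + `|M| * `|M|).
  move=> x; rewrite !mulrDl mul1r.
  have M0 := normr_ge0 M.
  apply: le_trans (hnormD _ _) _; apply: lerD; last first.
    by apply: le_trans (bF' _) _; rewrite -mulrA ler_wpM2l.
  apply: le_trans (hnormD _ _) _; apply: lerD; last first.
    by apply: le_trans (bF _) _; rewrite -mulrA ler_wpM2l.
  apply: le_trans (hnormB _ _) _; apply: lerD => //.
  by apply: le_trans (hnormB _ _) _; apply: lerD.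
(* As [F - F'] is skew, [re (N x) x = |x|^2 + |F x - F' x|^2]. *)
have coer x : 1 * re x x <= re (N x) x.
  have := re_ge0 (F x - F' x).
  have e1 : re (F x) (F' x) = re (F x) x by rewrite -aF iF.
  rewrite /N !reE (reC (F' x) (F x)) e1 (reC (F' x) x) -(aF x x) (aF (F' x)) (aF' (F x)).
  lra.
have aN : adj N N.
  by move=> x y; rewrite /N !reE !(aF, aF'); ring.
have [K [NK KN lK bK]] := lax_milgram lN bN ltr01 coer.
have aK : adj K K by move=> x y; rewrite -[in LHS](NK y) -aN NK.
(* [F N = F F' F = N F], and similarly for [F']; the inverse [K] inherits both commutations. *)
have FN x : F (N x) = F (F' (F x)).
  by rewrite /N !(linD lF, linN lF) !iF; hring.
have NF x : N (F x) = F (F' (F x)).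
  by rewrite /N !iF; hring.
have FN' x : F' (N x) = F' (F (F' x)).
  by rewrite /N !(linD lF', linN lF') !iF'; hring.
have NF' x : N (F' x) = F' (F (F' x)).
  by rewrite /N !iF'; hring.
have FK x : F (K x) = K (F x) by rewrite -[LHS]KN NF -FN NK.
have FK' x : F' (K x) = K (F' x) by rewrite -[LHS]KN NF' -FN' NK.
pose P x := F (F' (K x)).
have PF x : P (F x) = F x by rewrite /P -FK -FN NK.
exists P; split=> //; last by move=> x; rewrite /P iF.
apply: (@proj_intro _ (`|M| * (`|M| * (1 / 1)))) => //.
- by move=> a x y; rewrite /P lK lF' lF.
- move=> x; apply: le_trans (bF _) _; rewrite -mulrA ler_wpM2l //.
  by apply: le_trans (bF' _) _; rewrite -mulrA ler_wpM2l.
- by move=> x; rewrite {2}/P PF.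
- by move=> x y; rewrite /P aF aF' aK FK' FK.
Qed.

Lemma compl_op_le P x : is_proj ip P -> hnorm (x - P x) <= hnorm x.
Proof. by move=> hP; exact: (proj_le (compl_op_proj hP)). Qed.

(** Write [P - P' = P (1 - P') - (1 - P) P']. Since [(1 - P) F = 0] and [F' P' = P'], the second
    term is [(1 - P) (F' - F) P'], of norm at most [d]; the first is the adjoint of the same
    expression with the roles exchanged. *)
Lemma proj_dist P P' F F' d : is_proj ip P -> is_proj ip P' -> 0 <= d ->
  (forall x, F (P x) = P x) -> (forall x, P (F x) = F x) ->
  (forall x, F' (P' x) = P' x) -> (forall x, P' (F' x) = F' x) ->
  (forall x, hnorm (F x - F' x) <= d * hnorm x) ->
  opdist_le ip P P' (2 * d).
Proof.
move=> hP hP' d0 FP PF FP' PF' hF x.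
have lP := proj_lin hP; have lP' := proj_lin hP'.
have half A B E E' : is_proj ip A -> is_proj ip B -> (forall x, A (E x) = E x) ->
    (forall x, E' (B x) = B x) -> (forall x, hnorm (E x - E' x) <= d * hnorm x) ->
    bnd (fun x => compl_op A (B x)) d.
  move=> hA hB AE EB hE y.
  have -> : compl_op A (B y) = compl_op A (E' (B y) - E (B y)).
    rewrite (linB (proj_lin (compl_op_proj hA))) EB.
    by rewrite [X in _ - X]/compl_op AE subrr subr0.
  apply: le_trans (compl_op_le _ hA) _; rewrite hnorm_sym.
  by apply: le_trans (hE _) _; rewrite ler_wpM2l ?proj_le.
have h1 := half _ _ _ _ hP hP' PF FP' hF.
have h2 : bnd (fun x => P (compl_op P' x)) d.
  apply: (adj_bnd (T := fun x => compl_op P' (P x))) => //.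
    by move=> u v; rewrite (proj_adj (compl_op_proj hP')) (proj_adj hP).
  by apply: (half _ _ F' F) => // y; rewrite hnorm_sym.
have -> : P x - P' x = P (compl_op P' x) - compl_op P (P' x).
  by rewrite /compl_op linB //; hring.
apply: le_trans (hnormB _ _) _; have := h1 x; have := h2 x => /=; lra.
Qed.

Lemma opdist_eq P P' : opdist_le ip P P' 0 -> P = P'.
Proof.
move=> h; apply: funext => x; apply/eqP; rewrite -subr_eq0; apply/eqP/hnorm_le0.
by have := h x; rewrite mul0r.
Qed.

(* The convex combinations of the oblique projection onto [range P] and of the
   orthogonal one onto the complement of [range Q], both along [range Q], are
   again idempotents with kernel [range Q]. *)
Lemma compl_path P Q : is_proj ip P -> is_proj ip Q ->
  is_compl (range P) (range Q) ->
  exists (g : R -> H -> H) (L : R), [/\ g 0 = P, g 1 = compl_op Q, 0 <= L,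
    forall t, is_proj ip (g t) /\ is_compl (range (g t)) (range Q) &
    forall s t, opdist_le ip (g s) (g t) (L * `|s - t|)].
Proof.
move=> hP hQ hc.
have [F [F' [M [lF bF aF [PF FP] [FQ GF]]]]] := oblique_projection hP hQ hc.
have hG := compl_op_proj hQ.
have split_x x : compl_op Q x + Q x = x by rewrite /compl_op subrK.
set G := compl_op Q in hG GF split_x *.
have G0 x : Q x = x -> G x = 0 by rewrite /G /compl_op => ->; rewrite subrr.
clearbody G; have lQ := proj_lin hQ; have lG := proj_lin hG; have lP := proj_lin hP.
have FG x : F (G x) = F x.
  by rewrite -[in RHS](split_x x) linD // (FQ (Q x)) ?addr0 // proj_idem.
have FF x : F (F x) = F x by apply: FP.
have GG x : G (G x) = G x by apply: proj_idem.
have M0 : 0 <= `|M| + 1 by rewrite addr_ge0.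
have bGF x : hnorm (G x - F x) <= (`|M| + 1) * hnorm x.
  apply: le_trans (hnormB _ _) _; have := bF x; have := proj_le hG x.
  have := ler_wpM2r (hnorm_ge0 x) (ler_norm M); lra.
pose E t x := F x + rs t (G x - F x).
have lE t : lin (E t).
  by move=> a x y; rewrite /E lF lG /rs !(scalerDr, scalerN, scalerA) (mulrC a); hring.
have bE t : bnd (E t) (M + `|t| * (`|M| + 1)).
  move=> x; apply: le_trans (hnormD _ _) _; rewrite mulrDl lerD //.
  by rewrite hnorm_rs -mulrA ler_wpM2l.
have aE t : adj (E t) (fun y => F' y + rs t (G y - F' y)).
  by move=> x y; rewrite /E !reE aF (proj_adj hG).
have iE t x : E t (E t x) = E t x.
  by rewrite /E !(linD lF, linD lG, linR lF, linR lG, linN lF, linN lG) !FF !FG !GF !GG; hring.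
have GE t x : G (E t x) = G x.
  by rewrite /E (linD lG) (linR lG) (linB lG) GG GF; hring.
have [g hg] := choice (fun t => idempotent_range_proj (lE t) (bE t) (aE t) (iE t)).
have lip s t : opdist_le ip (g s) (g t) (2 * (`|M| + 1) * `|s - t|).
  have [hs1 hs2 hs3] := hg s; have [ht1 ht2 ht3] := hg t; rewrite -mulrA.
  apply: (proj_dist hs1 ht1 _ hs2 hs3 ht2 ht3); first by rewrite mulr_ge0.
  move=> x; have -> : E s x - E t x = rs (s - t) (G x - F x) by rewrite /E; hring.
  by rewrite hnorm_rs (mulrC (`|M| + 1)) -mulrA; apply: ler_wpM2l.
(* The projections [g t] come from choice; at the endpoints they are identified through [proj_dist]
   with distance zero. *)
have end_pt t A : is_proj ip A -> (forall x, E t (A x) = A x) ->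
    (forall x, A (E t x) = E t x) -> g t = A.
  move=> hA h1 h2; have [ht1 ht2 ht3] := hg t.
  apply: opdist_eq; rewrite -[0](mulr0 2).
  apply: (proj_dist ht1 hA (lexx 0) ht2 ht3 h1 h2) => x.
  by rewrite subrr hnorm0 mul0r.
have E0 x : E 0 x = F x by rewrite /E; hring.
have E1 x : E 1 x = G x by rewrite /E; hring.
exists g, (2 * (`|M| + 1)); split=> //.
- by apply: end_pt => // x; rewrite E0 // FP // proj_idem.
- by apply: end_pt => // x; rewrite E1.
- by rewrite mulr_ge0.
move=> t; have [ht1 ht2 ht3] := hg t; split=> //; split=> [x|x].
  move=> /(rangeP ht1) gx /(rangeP hQ) Qx.
  by rewrite -gx -ht2 gx /E (FQ _ Qx) (G0 _ Qx); hring.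
exists (E t x), (x - E t x); split; last split.
- by exists (E t x); rewrite ht3.
- apply/(rangeP hQ); rewrite -[RHS]split_x [G _](linB lG) GE; hring.
- hring.
Qed.

(** * Nearby projections and arcs *)

Lemma opdist_sym P Q e : opdist_le ip P Q e -> opdist_le ip Q P e.
Proof. by move=> h x; rewrite hnorm_sym. Qed.

Lemma infdim_ext (S S' : H -> Prop) :
  (forall x, S x <-> S' x) -> infdim S -> infdim S'.
Proof.
move=> h iS s hs; have [|x [Sx hx]] := iS s; first by move=> i /hs /h.
by exists x; split=> //; apply/h.
Qed.

(** The equation [x = y + P (P - Q) P x] is solved by contraction; applying [P] to it leaves
    [P Q P x = y]. *)
Lemma near_proj_onto P Q e y : is_proj ip P -> is_proj ip Q ->
  opdist_le ip P Q e -> e < 1 -> P y = y -> exists z, range Q z /\ P z = y.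
Proof.
move=> hP hQ PQ e1 Py; have lP := proj_lin hP; have lQ := proj_lin hQ.
(* [e] is not assumed nonnegative, but a contraction constant must be. *)
pose q := Num.max 0 e.
have q01 : 0 <= q < 1 by rewrite le_max lexx gt_max ltr01 e1.
have [||x hx] := @contraction_solve (fun x => P (P (P x) - Q (P x))) q y _ q01.
- by move=> a u v; rewrite 2!lP lQ opprD addrACA -scalerBr lP.
- move=> x; apply: le_trans (proj_le hP _) _; apply: le_trans (PQ _) _.
  have h1 := proj_le hP x.
  apply: (@le_trans _ _ (q * hnorm (P x))); last by rewrite ler_wpM2l // le_max lexx.
  by rewrite ler_wpM2r ?hnorm_ge0 // le_max lexx orbT.
exists (Q (P x)); split; first by exists (P x).
have h : P x = y + P (P (P x) - Q (P x)) by rewrite {1}hx linD // Py proj_idem.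
apply: (addrI (P x - P (Q (P x)))); rewrite subrK {1}h linB // !proj_idem //.
by rewrite addrC.
Qed.

(** [P] maps [range Q] onto [range P], so the image under [P] of a finite family spanning the former
    would span the latter. *)
Lemma near_infdim_range P Q e : is_proj ip P -> is_proj ip Q ->
  opdist_le ip P Q e -> e < 1 -> infdim (range P) -> infdim (range Q).
Proof.
move=> hP hQ PQ e1 iP s hs; have lP := proj_lin hP.
apply: contrapT => /forallNP h.
have [|x [/(rangeP hP) Px hx]] := iP (map P s).
  move=> i; rewrite size_map => si; rewrite (nth_map 0) //.
  by exists (nth 0 s i).
have [z [Qz Pz]] := near_proj_onto hP hQ PQ e1 Px.
have := h z; rewrite not_andE => -[//|/existsNP[c /contrapT zE]].
apply: (hx c); rewrite -Pz zE lin_sum // size_map.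
by apply: eq_bigr => i _; rewrite linZ // (nth_map 0).
Qed.

Lemma near_proj_inf_inf P Q e : proj_inf_inf ip P -> is_proj ip Q ->
  opdist_le ip P Q e -> e < 1 -> proj_inf_inf ip Q.
Proof.
move=> [hP [iR iK]] hQ PQ e1; split=> //; split.
  exact: (near_infdim_range hP hQ PQ e1).
have hP' := compl_op_proj hP; have hQ' := compl_op_proj hQ.
apply: (@infdim_ext (range (compl_op Q))) => [x|].
  by split=> /(kernel_compl_op _ hQ).
apply: (near_infdim_range hP' hQ' (e := e)) => //.
  move=> x; rewrite hnorm_sym; have -> : compl_op Q x - compl_op P x = P x - Q x.
    by rewrite /compl_op; hring.
  exact: PQ.
by apply: infdim_ext iK => x; apply: kernel_compl_op.
Qed.

(** A locally constant predicate is followed up to the supremum [m] of the [x] such that it holds on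
    [[0, x]]; it holds at [m] and slightly beyond, which forces [m = 1]. *)
Lemma unit_interval_connected (Q : R -> Prop) :
  (forall t, 0 <= t <= 1 -> exists d, 0 < d /\ forall s, 0 <= s <= 1 ->
     `|s - t| < d -> (Q s <-> Q t)) ->
  Q 0 -> forall t, 0 <= t <= 1 -> Q t.
Proof.
move=> loc Q0.
pose E : R -> Prop := fun x => 0 <= x <= 1 /\ forall y, 0 <= y <= x -> Q y.
have E0 : E 0.
  split=> [|y h]; first by rewrite lexx ler01.
  by have -> : y = 0 by lra.
have sE : classical_sets.has_sup E.
  by split; [exists 0|exists 1 => x [/andP[]]].
pose m := sup E.
have ubm x : E x -> x <= m by move=> Ex; exact: sup_upper_bound.
have m0 := ubm _ E0.
have m1 : m <= 1 by apply: ge_sup; [exists 0|move=> x [/andP[]]].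
have [|d [d0 hd]] := loc m; first by rewrite m0.
have [x [x01 Qx] xm] := sup_adherent d0 sE; rewrite -/m in xm.
have xm' := ubm x (conj x01 Qx).
have Qm : Q m.
  apply/(hd x) => //; first by rewrite ler0_norm; lra.
  by apply: Qx; rewrite lexx andbT; lra.
have Ew : E (Num.min 1 (m + d / 2)).
  split=> [|y /andP[y0 yw]].
    by rewrite le_min ge_min lexx ler01 /= andbT; lra.
  rewrite le_min in yw.
  have [yx|xy] := leP y x; first by apply: Qx; rewrite y0.
  by apply/(hd y) => //; [lra|rewrite ltr_norml; lra].
move=> t /andP[t0 t1]; apply: Ew.2; rewrite t0 /=.
have := ubm _ Ew; rewrite ge_min => /orP[h|]; last by lra.
by rewrite le_min t1 /=; lra.
Qed.

Local Notation pair := ((H -> H) * (H -> H))%type.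

(** The clause of [arcwise_connected] for fixed endpoints, isolated so that arcs can be reversed and
    concatenated. *)
Definition joined (A : pair -> Prop) (a b : pair) : Prop :=
  exists g : R -> pair,
    [/\ g 0 = a, g 1 = b, (forall t, 0 <= t <= 1 -> A (g t)) &
        (forall t, 0 <= t <= 1 -> forall e, 0 < e ->
           exists d, 0 < d /\ forall s, 0 <= s <= 1 ->
             `|s - t| < d -> near_pair ip e (g s) (g t))].

Lemma joined_sym A a b : joined A a b -> joined A b a.
Proof.
move=> [g [g0 g1 gA gc]]; exists (fun t => g (1 - t)); split.
- by rewrite subr0.
- by rewrite subrr.
- by move=> t t01; apply: gA; lra.
move=> t t01 e e0; have [|d [d0 hd]] := gc (1 - t) _ e e0; first by lra.
exists d; split=> // s s01 st; apply: hd; first by lra.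
have -> : 1 - s - (1 - t) = t - s by ring.
by rewrite distrC.
Qed.

Lemma joined_trans A a b c : joined A a b -> joined A b c -> joined A a c.
Proof.
move=> [g [g0 g1 gA gc]] [k [k0 k1 kA kc]].
exists (fun t => if t <= 1 / 2 then g (2 * t) else k (2 * t - 1)); split.
- by rewrite ifT ?mulr0 //; lra.
- by rewrite ifF; [have -> : 2 * 1 - 1 = 1 :> R by ring|apply/negbTE; rewrite -ltNge; lra].
- by move=> t t01; case: leP => h; [apply: gA|apply: kA]; lra.
move=> t t01 e e0; case: (ltrgtP t (1 / 2)) => ht.
- have [|d [d0 hd]] := gc (2 * t) _ e e0; first by lra.
  exists (Num.min (d / 2) (1 / 2 - t)); split; first by rewrite lt_min; lra.
  move=> s s01; rewrite lt_min => /andP[h1 h2].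
  have hs : s <= 1 / 2 by move: h2; rewrite ltr_norml; lra.
  rewrite hs; apply: hd; first by lra.
  by rewrite -mulrBr normrM ger0_norm //; lra.
- have [|d [d0 hd]] := kc (2 * t - 1) _ e e0; first by lra.
  exists (Num.min (d / 2) (t - 1 / 2)); split; first by rewrite lt_min; lra.
  move=> s s01; rewrite lt_min => /andP[h1 h2].
  have hs : 1 / 2 < s by move: h2; rewrite ltr_norml; lra.
  rewrite leNgt hs /=; apply: hd; first by lra.
  have -> : 2 * s - 1 - (2 * t - 1) = 2 * (s - t) by ring.
  by rewrite normrM ger0_norm //; lra.
- have [|d1 [d10 hd1]] := gc 1 _ e e0; first by lra.
  have [|d2 [d20 hd2]] := kc 0 _ e e0; first by lra.
  exists (Num.min (d1 / 2) (d2 / 2)); split; first by rewrite lt_min; lra.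
  move=> s s01; rewrite lt_min => /andP[h1 h2].
  have -> : g (2 * t) = g 1 by congr g; rewrite ht; field.
  case: leP => hs.
    apply: hd1; first by lra.
    have -> : 2 * s - 1 = 2 * (s - t) by rewrite ht; field.
    by rewrite normrM ger0_norm //; lra.
  rewrite g1 -k0; apply: hd2; first by lra.
  have -> : 2 * s - 1 - 0 = 2 * (s - t) by rewrite ht; field.
  by rewrite normrM ger0_norm //; lra.
Qed.

Lemma lipschitz_joined A (g k : R -> H -> H) L : 0 <= L ->
  (forall t, 0 <= t <= 1 -> A (g t, k t)) ->
  (forall s t, opdist_le ip (g s) (g t) (L * `|s - t|)) ->
  (forall s t, opdist_le ip (k s) (k t) (L * `|s - t|)) ->
  joined A (g 0, k 0) (g 1, k 1).
Proof.
move=> L0 hA hg hk; exists (fun t => (g t, k t)); split=> // t t01 e e0.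
(* [L] may be zero, so the modulus of continuity divides by [L + 1]. *)
have L1 : 0 < L + 1 by lra.
exists (e / (L + 1)); split; first exact: divr_gt0.
move=> s s01; rewrite ltr_pdivlMr // => st.
have Le : L * `|s - t| <= e by have := normr_ge0 (s - t); lra.
split=> x /=; [apply: le_trans (hg _ _ _) _|apply: le_trans (hk _ _ _) _];
by apply: ler_wpM2r; rewrite ?hnorm_ge0.
Qed.

(** By [near_proj_inf_inf] the property is locally constant along the path; connectedness of the
    interval is applied to it and to its negation. *)
Lemma lipschitz_path_inf_inf (g : R -> H -> H) L : 0 <= L ->
  (forall t, is_proj ip (g t)) ->
  (forall s t, opdist_le ip (g s) (g t) (L * `|s - t|)) ->
  forall t, 0 <= t <= 1 -> (proj_inf_inf ip (g 0) <-> proj_inf_inf ip (g t)).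
Proof.
move=> L0 hg lip; have L1 : 0 < L + 1 by lra.
have step s t : `|s - t| < 1 / (L + 1) -> proj_inf_inf ip (g s) -> proj_inf_inf ip (g t).
  rewrite ltr_pdivlMr // => st hs; apply: near_proj_inf_inf hs (hg t) (lip s t) _.
  by have := normr_ge0 (s - t); lra.
have loc t : exists d, 0 < d /\ forall s, 0 <= s <= 1 -> `|s - t| < d ->
    (proj_inf_inf ip (g s) <-> proj_inf_inf ip (g t)).
  exists (1 / (L + 1)); split; first exact: divr_gt0.
  by move=> s _ st; split; apply: step => //; rewrite distrC.
move=> t t01; split=> [h|h].
  exact: (@unit_interval_connected (fun t => proj_inf_inf ip (g t))).
apply: contrapT => n0.
apply: (@unit_interval_connected (fun t => ~ proj_inf_inf ip (g t)) _ n0 t t01 h).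
move=> u _; have [d [d0 hd]] := loc u; exists d; split=> // s s01 su.
by have := hd s s01 su; tauto.
Qed.

(** * Orthonormal sequences and partial isometries *)

Lemma ipBl x y z : ip (x - y) z = ip x z - ip y z.
Proof. by rewrite ipDl -scaleN1r ipZl mulN1r. Qed.

Lemma ip_self x : ip x x = (re x x +i* 0)%C.
Proof.
rewrite /re; have := ip_conj x x; case: (ip x x) => a b /= [] h.
by congr (_ +i* _)%C; lra.
Qed.

Lemma ip_sym0 x y : ip x y = 0 -> ip y x = 0.
Proof. by rewrite (ip_conj x y) => ->; rewrite /conjc /= oppr0. Qed.

Lemma re_jl x y : re x (jx y) = re (- jx x) y.
Proof. by rewrite reNl /re ipZr ipZl; case: (ip x y) => a b /=; ring. Qed.

Lemma ip_adj T T' : lin T -> adj T T' -> forall x y, ip (T x) y = ip x (T' y).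
Proof.
move=> lT h x y; rewrite ip_re h [RHS]ip_re; congr (_ +i* _)%C.
have e : - jx (T x) = T (- jx x) by rewrite /jx (linN lT) (linZ lT).
by rewrite [LHS]re_jl e h [RHS]re_jl.
Qed.

Section OrthogonalVectors.
Variables (S : H -> Prop).
Hypothesis subS : forall (a : C) x y, S x -> S y -> S (a *: x + y).

(** If some [u] in [S] is not orthogonal to [w], a vector of [S] outside the span of [u :: s]
    becomes orthogonal to [w] after subtracting a multiple of [u], and remains outside the span of
    [s]. *)
Lemma infdim_orth1 w : infdim S -> infdim (fun x => S x /\ ip x w = 0).
Proof.
move=> iS s hs.
have [[u [Su uw]]|no] := pselect (exists u, S u /\ ip u w <> 0); last first.
  have [|x [Sx hx]] := iS s; first by move=> i /hs[].
  exists x; split=> //; split=> //; apply: contrapT => xw.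
  by apply: no; exists x.
have [|x [Sx hx]] := iS (u :: s).
  by case=> [//|i] /= /hs [].
pose a := ip x w / ip u w.
exists (- a *: u + x); split=> [|c e].
  split; first exact: subS.
  by rewrite ip_lin /a mulNr divfK ?addNr //; apply/eqP.
apply: (hx (fun i => if i is j.+1 then c j else a)).
rewrite /= big_ord_recl /=; apply: (addrI (- a *: u)).
by rewrite addrA -scalerDl addNr scale0r add0r e.
Qed.

End OrthogonalVectors.

Definition orth_to (l : seq H) (x : H) : Prop := forall w, w \in l -> ip x w = 0.

Lemma infdim_orth (S : H -> Prop) l :
  (forall (a : C) x y, S x -> S y -> S (a *: x + y)) -> infdim S ->
  infdim (fun x => S x /\ orth_to l x).
Proof.
move=> subS iS; elim: l => [|w l IH]; first by apply: infdim_ext iS => x; split=> [|[]].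
have subl (a : C) x y : S x /\ orth_to l x -> S y /\ orth_to l y ->
    S (a *: x + y) /\ orth_to l (a *: x + y).
  move=> [Sx xl] [Sy yl]; split=> [|v vl]; first exact: subS.
  by rewrite ip_lin xl // yl // mulr0 addr0.
apply: infdim_ext (@infdim_orth1 _ subl w IH) => x.
split=> [[[Sx xl] xw]|[Sx xl]].
  by split=> // v; rewrite inE => /orP[/eqP->|/xl].
by do !split=> //; [move=> v vl; apply: xl; rewrite inE vl orbT|apply: xl; rewrite mem_head].
Qed.

Definition unitv (x : H) : H := rs (1 / hnorm x) x.

Lemma unitvP x : x <> 0 -> ip (unitv x) (unitv x) = 1 /\ x = rs (hnorm x) (unitv x).
Proof.
move=> x0; have hx : hnorm x != 0.
  by apply/eqP => e; apply: x0; apply: hnorm_le0; rewrite e.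
split; last by apply: re_ext => z; rewrite !reE; field.
rewrite ip_self !reE -hnorm2.
have -> : 1 / hnorm x * (1 / hnorm x * hnorm x ^+ 2) = 1 by field.
by [].
Qed.

Lemma unit_orth (S : H -> Prop) l :
  (forall (a : C) x y, S x -> S y -> S (a *: x + y)) -> infdim S ->
  exists v, [/\ S v, ip v v = 1 & orth_to l v].
Proof.
move=> subS iS; have [|x [[Sx xl] hx]] := @infdim_orth S l subS iS [::]; first by [].
have x0 : x <> 0 by move=> e; apply: (hx (fun=> 0)); rewrite big_ord0.
have [h1 h2] := unitvP x0; exists (unitv x); split=> //.
  (* Closure under [a *: x + y] is all that is known of [S], so [0] is first obtained as
     [- x + x]. *)
  rewrite -[unitv x]addr0; apply: (subS) => //.
  by rewrite -(addNr x) -scaleN1r; apply: subS.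
by move=> w wl; rewrite /unitv ipZl xl // mulr0.
Qed.

(** Gram-Schmidt for a list that need not be orthogonal or independent. That [h - r] lies in the
    span of [l] is expressed by pairing with the vectors orthogonal to [l]. The residual [v] of the
    head [w] over the tail gives the new direction, unless it is zero. *)
Lemma residual (S : H -> Prop) l h :
  (forall (a : C) x y, S x -> S y -> S (a *: x + y)) ->
  (forall w, w \in l -> S w) -> S h ->
  exists r, [/\ S r, orth_to l r & forall z, orth_to l z -> ip z r = ip z h].
Proof.
move=> subS; elim: l h => [|w l IH] h lS Sh; first by exists h.
have {}IH k : S k -> exists r, [/\ S r, orth_to l r & forall z, orth_to l z -> ip z r = ip z k].
  by apply: IH => v vl; apply: lS; rewrite inE vl orbT.
have [r [Sr rl hr]] := IH h Sh.
have [|v [Sv vl hv]] := IH w; first by apply: lS; rewrite mem_head.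
have orth_cons x : orth_to (w :: l) x <-> orth_to l x /\ ip x w = 0.
  split=> [xl|[xl xw] u].
    by split=> [u ul|]; apply: xl; rewrite ?mem_head // inE ul orbT.
  by rewrite inE => /orP[/eqP->|/xl].
have [v0|v0] := pselect (v = 0).
  have rw0 z : orth_to l z -> ip z w = 0 by move=> zl; rewrite -hv // v0 ip0r.
  exists r; split=> //; first by apply/orth_cons; split=> //; apply: rw0.
  by move=> z /orth_cons[zl _]; apply: hr.
have vv : ip v v != 0.
  by apply/eqP => e; apply: v0; apply: re_eq0; rewrite /re e.
pose a := - (ip r v / ip v v).
have ol : orth_to l (a *: v + r).
  by move=> u ul; rewrite ip_lin vl // rl // mulr0 addr0.
exists (a *: v + r); split; first exact: subS.
  by apply/orth_cons; split=> //; rewrite -hv // ip_lin /a mulNr divfK // addNr.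
by move=> z /orth_cons[zl zw]; rewrite ipDr ipZr hv // zw mulr0 add0r hr.
Qed.

(** Choice in which each term may depend on all the earlier ones, by iterating on the list built so
    far. *)
Lemma choose_sequence (T : Type) (Pr : seq T -> T -> Prop) :
  (forall l, exists v, Pr l v) -> exists e : nat -> T, forall n, Pr (mkseq e n) (e n).
Proof.
move=> /choice[nxt hn].
pose L n := iter n (fun l => rcons l (nxt l)) [::].
exists (fun n => nxt (L n)) => n.
suff -> : mkseq (fun n => nxt (L n)) n = L n by [].
by elim: n => [//|n IH]; rewrite mkseqS IH.
Qed.

Definition orthon (e : nat -> H) : Prop :=
  forall j k, ip (e j) (e k) = (j == k)%:R.

Lemma orthon_of_prefix e : (forall n, ip (e n) (e n) = 1) ->
  (forall n, orth_to (mkseq e n) (e n)) -> orthon e.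
Proof.
move=> e1 eo; have lt j k : (j < k)%N -> ip (e k) (e j) = 0.
  by move=> jk; apply: eo; apply: map_f; rewrite mem_iota.
move=> j k; case: (ltngtP j k) => [jk|kj|->]; last by rewrite e1.
  by apply: ip_sym0; apply: lt.
exact: lt.
Qed.

Lemma proj_range_sub P : is_proj ip P ->
  forall (a : C) x y, P x = x -> P y = y -> P (a *: x + y) = a *: x + y.
Proof. by move=> hP a x y Px Py; rewrite (proj_lin hP) Px Py. Qed.

Lemma infdim_fix P : is_proj ip P -> infdim (range P) -> infdim (fun x => P x = x).
Proof. by move=> hP; apply: infdim_ext => x; apply: rangeP. Qed.

(* At stage [n] the residual of [P (d n)] is adjoined if it is non-zero, where
   [d] is dense; otherwise any unit vector orthogonal to the previous ones. *)
Lemma orthonormal_basis P : is_proj ip P -> infdim (range P) ->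
  exists e, [/\ orthon e, forall k, P (e k) = e k &
    forall x, P x = x -> (forall k, ip x (e k) = 0) -> x = 0].
Proof.
move=> hP /(infdim_fix hP) iP; have subP := proj_range_sub hP.
have [_ [_ [_ [_ [_ [[d dense] _]]]]]] := hilb.
(* The last clause makes every vector orthogonal to [l] and [v] orthogonal to [P (d n)], with [n]
   the length of [l]. A vector of [range P] orthogonal to all the [e k] is then orthogonal to the
   dense sequence. *)
pose Pr l v := [/\ P v = v, ip v v = 1, orth_to l v &
  (forall w, w \in l -> P w = w) ->
  forall z, orth_to l z -> ip z v = 0 -> ip z (P (d (size l))) = 0].
have [l|e he] := @choose_sequence _ Pr.
  have [v [Pv v1 vl]] := unit_orth l subP iP.
  have [lS|lS] := pselect (forall w, w \in l -> P w = w); last by exists v.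
  have [r [Sr rl hr]] := residual subP lS (proj_idem hP (d (size l))).
  have [r0|r0] := pselect (r = 0).
    by exists v; split=> // _ z zl _; rewrite -hr // r0 ip0r.
  have [h1 h2] := unitvP r0; exists (unitv r); split=> //.
  - by rewrite /unitv linR ?Sr //; exact: proj_lin.
  - by move=> w wl; rewrite /unitv ipZl rl // mulr0.
  - by move=> _ z zl zv; rewrite -hr // h2 ipZr zv mulr0.
have eP k : P (e k) = e k by have [] := he k.
exists e; split=> //.
  by apply: orthon_of_prefix => n; have [] := he n.
move=> x Px xe; apply: hnorm_le0; apply/ler_addgt0Pr => c c0; rewrite add0r.
have xd n : re x (d n) = 0.
  rewrite -Px (proj_adj hP) /re; have [_ _ _ h] := he n.
  rewrite size_mkseq in h; rewrite h //; first by move=> w /mapP[k _ ->].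
  by move=> w /mapP[k _ ->].
have [n hn] := dense x c c0.
have [->|xn] := eqVneq (hnorm x) 0; first exact: ltW.
have xp : 0 < hnorm x by rewrite lt_neqAle eq_sym xn hnorm_ge0.
rewrite -(ler_pM2l xp) -expr2 hnorm2.
have -> : re x x = re x (x - d n) by rewrite reDr reNr xd subr0.
by apply: le_trans (re_le _ _) _; rewrite ler_pM2l // ltW.
Qed.

(** * Convergence of orthonormal series *)

Definition psum (c : nat -> C) (f : nat -> H) n : H := \sum_(k < n) c k *: f k.
Definition n2 (z : C) : R := complex.Re z ^+ 2 + complex.Im z ^+ 2.

Lemma psumS c f n : psum c f n.+1 = psum c f n + c n *: f n.
Proof. by rewrite /psum big_ord_recr. Qed.

Lemma psum0 c f : psum c f 0 = 0.
Proof. by rewrite /psum big_ord0. Qed.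

Lemma ip_psum_orth c f n y : (forall k, ip (f k) y = 0) -> ip (psum c f n) y = 0.
Proof.
move=> h; elim: n => [|n IH]; first by rewrite psum0 ip0l.
by rewrite psumS ipDl IH ipZl h mulr0 addr0.
Qed.

Lemma ip_psum c f n j : orthon f ->
  ip (psum c f n) (f j) = if (j < n)%N then c j else 0.
Proof.
move=> of_; elim: n => [|n IH]; first by rewrite psum0 ip0l.
rewrite psumS ipDl IH ipZl of_ ltnS.
by case: (ltngtP j n) => [jn|jn|->]; rewrite ?mulr0 ?addr0 ?mulr1 ?add0r.
Qed.

Lemma psum_tail c f m n : orthon f -> (n <= m)%N ->
  re (psum c f m - psum c f n) (psum c f m - psum c f n) =
  \sum_(k < m) n2 (c k) - \sum_(k < n) n2 (c k).
Proof.
move=> of_; elim: m => [|m IH]; first by rewrite leqn0 => /eqP->; rewrite !subrr re0l.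
rewrite leq_eqVlt => /orP[/eqP->|]; first by rewrite !subrr re0l.
rewrite ltnS => nm; rewrite psumS big_ord_recr /=.
have h0 : ip (psum c f m - psum c f n) (f m) = 0.
  by rewrite ipBl !ip_psum // ltnn ltnNge nm /= subrr.
have -> : psum c f m + c m *: f m - psum c f n = (psum c f m - psum c f n) + c m *: f m.
  by rewrite addrAC.
move: (psum c f m - psum c f n) h0 (IH nm) => u h0 hu.
have h1 : re u (c m *: f m) = 0 by rewrite /re ipZr h0 mulr0.
have h2 : re (c m *: f m) (c m *: f m) = n2 (c m).
  by rewrite /re ipZr ipZl of_ eqxx /n2; case: (c m) => a b /=; ring.
by rewrite reDl !reDr (reC (_ *: _) u) h1 h2 hu; ring.
Qed.

Lemma psum_sqr c f n : orthon f ->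
  re (psum c f n) (psum c f n) = \sum_(k < n) n2 (c k).
Proof.
by move=> of_; have := psum_tail c of_ (leq0n n); rewrite psum0 big_ord0 !subr0.
Qed.

(** By [psum_tail] squared distances of partial sums are increments of a bounded increasing real
    sequence, which are small once it is close to its supremum. *)
Lemma psum_tends (c : nat -> C) f (B : R) : orthon f ->
  (forall n, \sum_(k < n) n2 (c k) <= B) ->
  exists l, tends (psum c f) l.
Proof.
move=> of_ hB; pose a n := \sum_(k < n) n2 (c k).
have mono m n : (n <= m)%N -> a n <= a m.
  by move=> nm; have := re_ge0 (psum c f m - psum c f n); rewrite psum_tail // subr_ge0.
pose E : R -> Prop := fun x => exists n, x = a n.
have sE : classical_sets.has_sup E.
  by split; [exists (a 0%N), 0%N|exists B => _ [n ->]; exact: hB].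
apply: complete => e e0.
have [_ [N ->] hN] := sup_adherent (exprn_gt0 2 e0) sE.
have ub n : a n <= sup E by apply: sup_upper_bound => //; exists n.
have main m n : (N <= n)%N -> (n <= m)%N -> hnorm (psum c f m - psum c f n) < e.
  move=> Nn nm; rewrite -(@ltr_pXn2r _ 2) ?nnegrE ?hnorm_ge0 ?(ltW e0) //.
  rewrite hnorm2 psum_tail // -/(a m) -/(a n).
  by have := ub m; have := mono _ _ Nn; lra.
exists N => m n Nm Nn; have [nm|/ltnW mn] := leqP n m; first exact: main.
by rewrite hnorm_sym; apply: main.
Qed.

Lemma tends_unique u l l' : tends u l -> tends u l' -> l = l'.
Proof.
move=> h h'; apply/eqP; rewrite -subr_eq0; apply/eqP/hnorm_le0.
apply/ler_addgt0Pr => e e0; have e2 : 0 < e / 2 by lra.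
have [N hN] := h _ e2; have [N' hN'] := h' _ e2.
have := hN _ (leq_maxl N N'); have := hN' _ (leq_maxr N N').
have := hnorm_tri (u (maxn N N')) l l'; rewrite (hnorm_sym l (u _)); lra.
Qed.

Lemma tends_cst x : tends (fun=> x) x.
Proof. by move=> e e0; exists 0%N => n _; rewrite subrr hnorm0. Qed.

Lemma tends_bnd u l M : tends u l -> (forall n, hnorm (u n) <= M) -> hnorm l <= M.
Proof.
move=> h hM; apply/ler_addgt0Pr => e e0; have [N hN] := h _ e0.
have h1 := hN _ (leqnn N); have h2 := hM N.
have -> : l = u N - (u N - l) by hring.
by apply: le_trans (hnormB _ _) _; lra.
Qed.

(** Both pairings pass to the limit at once. The threshold [N] admits identities that hold only for
    long enough partial sums. *)
Lemma tends_re u v l m x y N : tends u l -> tends v m ->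
  (forall n, (N <= n)%N -> re (u n) y = re x (v n)) -> re l y = re x m.
Proof.
move=> hu hv h; apply/eqP; rewrite -subr_eq0 -normr_le0; apply/ler_addgt0Pr => e e0.
pose M := hnorm y + hnorm x + 1.
have x0 := hnorm_ge0 x; have y0 := hnorm_ge0 y.
have M0 : 0 < M by rewrite /M; lra.
have [N1 h1] := hu _ (divr_gt0 e0 M0); have [N2 h2] := hv _ (divr_gt0 e0 M0).
pose n := maxn N (maxn N1 N2).
have hn := h n (leq_maxl _ _).
have {}h1 : hnorm (u n - l) < e / M.
  by apply: h1; rewrite /n (leq_trans (leq_maxl N1 N2)) // leq_maxr.
have {}h2 : hnorm (v n - m) < e / M.
  by apply: h2; rewrite /n (leq_trans (leq_maxr N1 N2)) // leq_maxr.
have -> : re l y - re x m = re x (v n - m) - re (u n - l) y.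
  by rewrite !reE hn; ring.
apply: le_trans (ler_normB _ _) _; rewrite add0r.
have h3 := cauchy_schwarz x (v n - m); have h4 := cauchy_schwarz (u n - l) y.
have h5 := ler_wpM2l x0 (ltW h2); have h6 := ler_wpM2r y0 (ltW h1).
have h7 : e / M * M = e by rewrite divfK // gt_eqF.
have h8 : 0 < e / M by rewrite divr_gt0.
rewrite {1}/M in h7.
move: (e / M) h5 h6 h7 h8 => q h5 h6 h7 h8; rewrite /M in h7; lra.
Qed.

Lemma tends_ip u v l m x y N : tends u l -> tends v m ->
  (forall n, (N <= n)%N -> ip (u n) y = ip x (v n)) -> ip l y = ip x m.
Proof.
move=> hu hv h; rewrite ip_re [RHS]ip_re; congr (_ +i* _)%C.
  by apply: (tends_re hu hv (N := N)) => n Nn; rewrite /re h.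
(* Multiplication by i is moved from the limit [m] to the fixed vector [x]. *)
rewrite [RHS]re_jl; apply: (tends_re hu hv (N := N)) => n Nn.
by rewrite -re_jl !re_jr h.
Qed.

Lemma scale_rsC a t x : a *: rs t x = rs t (a *: x).
Proof. by rewrite /rs !scalerA mulrC. Qed.

(* [W] is the partial isometry [\sum_k <., e k> f k]. *)
Definition ptl (e f : nat -> H) (W : H -> H) : Prop :=
  forall x, tends (psum (fun k => ip x (e k)) f) (W x).

Lemma re_psum_coef e x n :
  re x (psum (fun k => ip x (e k)) e n) = \sum_(k < n) n2 (ip x (e k)).
Proof.
elim: n => [|n IH]; first by rewrite psum0 big_ord0 re0r.
rewrite psumS big_ord_recr reDr IH /=; congr (_ + _).
by rewrite /re ipZr /n2; case: (ip x (e n)) => a b /=; ring.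
Qed.

Lemma bessel e x n : orthon e -> \sum_(k < n) n2 (ip x (e k)) <= re x x.
Proof.
move=> oe; have := re_ge0 (x - psum (fun k => ip x (e k)) e n).
have h1 := psum_sqr (fun k => ip x (e k)) n oe; have h2 := re_psum_coef e x n.
by rewrite reDl !reDr !reNl !reNr (reC (psum _ _ _) x) h1 h2; lra.
Qed.

Lemma ptl_exists e f : orthon e -> orthon f -> exists W, ptl e f W.
Proof.
move=> oe of_.
have [x|W hW] := choice (P := fun x l => tends (psum (fun k => ip x (e k)) f) l).
  by apply: (psum_tends (B := re x x)) => // n; apply: bessel.
by exists W.
Qed.

Lemma ptl_unique e f W W' : ptl e f W -> ptl e f W' -> W = W'.
Proof. by move=> h h'; apply: funext => x; apply: tends_unique (h x) (h' x). Qed.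

Lemma ptl_bnd e f W : orthon e -> orthon f -> ptl e f W -> bnd W 1.
Proof.
move=> oe of_ hW x; rewrite mul1r; apply: (tends_bnd (hW x)) => n.
by rewrite hnorm_sqr_le psum_sqr // bessel.
Qed.

Lemma ptl_ip_adj e f W W' : ptl e f W -> ptl f e W' ->
  forall x y, ip (W x) y = ip x (W' y).
Proof.
move=> hW hW' x y; apply: (tends_ip (hW x) (hW' y) (N := 0%N)) => n _.
elim: n => [|n IH]; first by rewrite !psum0 ip0l ip0r.
rewrite !psumS ipDl ipDr IH ipZl ipZr (ip_conj (f n) y); congr (_ + _).
by case: (ip x (e n)) (ip (f n) y) => [a b] [c d] /=; simpc; congr (_ +i* _)%C; ring.
Qed.

Lemma ip_ext x y : (forall z, ip x z = ip y z) -> x = y.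
Proof. by move=> h; apply: re_ext => z; rewrite /re h. Qed.

(** Linearity follows from the existence of an adjoint, the partial isometry with [e] and [f]
    exchanged. *)
Lemma ptl_lin e f W : orthon e -> orthon f -> ptl e f W -> lin W.
Proof.
move=> oe of_ hW a x y; have [W' hW'] := ptl_exists of_ oe.
by apply: ip_ext => z; rewrite !(ip_lin, ptl_ip_adj hW hW').
Qed.

Lemma ptl_adj e f W W' : ptl e f W -> ptl f e W' -> adj W W'.
Proof. by move=> h h' x y; rewrite /re (ptl_ip_adj h h'). Qed.

Lemma ptl_coef e f W x k : orthon f -> ptl e f W -> ip (W x) (f k) = ip x (e k).
Proof.
move=> of_ hW; apply: (tends_ip (hW x) (tends_cst (e k)) (N := k.+1)) => n kn.
by rewrite ip_psum // kn.
Qed.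

Lemma ptl_orth e f W x y : ptl e f W -> (forall k, ip (f k) y = 0) -> ip (W x) y = 0.
Proof.
move=> hW h; rewrite -(ip0r 0); apply: (tends_ip (hW x) (tends_cst 0) (N := 0%N)) => n _.
by rewrite ip_psum_orth // ip0r.
Qed.

Lemma ptl_congr e f W x y : ptl e f W -> (forall k, ip x (e k) = ip y (e k)) ->
  W x = W y.
Proof.
move=> hW h; apply: tends_unique (hW x) _.
by have -> : (fun k => ip x (e k)) = (fun k => ip y (e k)) by apply: funext.
Qed.

(** The coefficients of [W x] along [f] are those of [x] along [e], so both series along [g]
    coincide. *)
Lemma ptl_comp e f g W V : orthon f -> ptl e f W -> ptl f g V -> ptl e g (V \o W).
Proof.
move=> of_ hW hV x /=; have := hV (W x).
by have -> : (fun k => ip (W x) (f k)) = (fun k => ip x (e k))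
  by apply: funext => k; apply: ptl_coef.
Qed.

Lemma ptl_proj e P : orthon e -> ptl e e P -> is_proj ip P.
Proof.
move=> oe hP; apply: (@proj_intro _ 1).
- exact: ptl_lin hP.
- exact: ptl_bnd hP.
- by move=> x; rewrite -[LHS]/((P \o P) x) (ptl_unique (ptl_comp oe hP hP) hP).
- exact: (ptl_adj hP hP).
Qed.

Lemma ptl_fix e P k : orthon e -> ptl e e P -> P (e k) = e k.
Proof.
move=> oe hP; apply: ip_ext => z.
by rewrite (ptl_ip_adj hP hP) ip_conj (ptl_coef z k oe hP) -ip_conj.
Qed.

Lemma ptl_kill e P y : orthon e -> ptl e e P -> (forall k, ip y (e k) = 0) -> P y = 0.
Proof.
move=> oe hP h; rewrite -(lin0 (ptl_lin oe oe hP)); apply: (ptl_congr hP) => k.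
by rewrite h ip0l.
Qed.

(** Let [E] be the sum of the series along a basis of [range P]. Then [P x - E x] lies in [range P]
    and is orthogonal to the basis, hence vanishes. *)
Lemma proj_ptl P : is_proj ip P -> infdim (range P) ->
  exists e, [/\ orthon e, ptl e e P & forall k, P (e k) = e k].
Proof.
move=> hP iP; have [e [oe eP basis]] := orthonormal_basis hP iP.
have [E hE] := ptl_exists oe oe; exists e; split=> //.
have lP := proj_lin hP; have ipP := ip_adj lP (proj_adj hP).
have EP z : E (P z) = E z by apply: (ptl_congr hE) => k; rewrite ipP eP.
have PE x : P (E x) = E x.
  by apply: re_ext => z; rewrite (proj_adj hP) !(ptl_adj hE hE) EP.
suff -> : P = E by [].
apply: funext => x; apply/eqP; rewrite -subr_eq0; apply/eqP; apply: basis.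
  by rewrite linB // proj_idem // PE.
by move=> k; rewrite ipBl ipP eP (ptl_coef x k oe hE) subrr.
Qed.

(* With [W] the partial isometry mapping [e] to [f], the common complement is the
   graph of [-W] plus the orthogonal complement of the two ranges. *)
Lemma orthogonal_common_compl e f P P' : orthon e -> orthon f ->
  (forall j k, ip (e j) (f k) = 0) -> ptl e e P -> ptl f f P' ->
  exists Q, [/\ is_proj ip Q, is_compl (range P) (range Q) & is_compl (range P') (range Q)].
Proof.
move=> oe of_ ef hP hP'.
have fe j k : ip (f j) (e k) = 0 by apply: ip_sym0.
have [W hW] := ptl_exists oe of_; have [W' hW'] := ptl_exists of_ oe.
have lP := ptl_lin oe oe hP; have lP' := ptl_lin of_ of_ hP'.
have lW := ptl_lin oe of_ hW; have lW' := ptl_lin of_ oe hW'.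
(* [comp] and [zero] give the multiplication table of [P], [P'], [W], [W'], that of the 2 by 2
   matrix units. *)
have comp a b c A B E : orthon b -> ptl a b A -> ptl b c B -> ptl a c E ->
    forall x, B (A x) = E x.
  by move=> ob hA hB hE x; rewrite -[LHS]/((B \o A) x) (ptl_unique (ptl_comp ob hA hB) hE).
have zero a b c d A B : ptl a b A -> ptl c d B -> orthon c -> orthon d ->
    (forall j k, ip (b j) (c k) = 0) -> forall x, B (A x) = 0.
  move=> hA hB oc od bc x; rewrite -(lin0 (ptl_lin oc od hB)).
  by apply: (ptl_congr hB) => k; rewrite ip0l (ptl_orth x hA).
have PP := comp _ _ _ _ _ _ oe hP hP hP; have PP' := comp _ _ _ _ _ _ of_ hP' hP' hP'.
have WP := comp _ _ _ _ _ _ oe hP hW hW; have P'W := comp _ _ _ _ _ _ of_ hW hP' hW.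
have PW' := comp _ _ _ _ _ _ oe hW' hP hW'; have W'P' := comp _ _ _ _ _ _ of_ hP' hW' hW'.
have W'W := comp _ _ _ _ _ _ of_ hW hW' hP; have WW' := comp _ _ _ _ _ _ oe hW' hW hP'.
have PQ := zero _ _ _ _ _ _ hP' hP oe oe fe; have QP := zero _ _ _ _ _ _ hP hP' of_ of_ ef.
have WW := zero _ _ _ _ _ _ hW hW oe of_ fe; have PW := zero _ _ _ _ _ _ hW hP oe oe fe.
have WP' := zero _ _ _ _ _ _ hP' hW oe of_ fe.
have W2 := zero _ _ _ _ _ _ hW' hW' of_ oe ef; have P'W' := zero _ _ _ _ _ _ hW' hP' of_ of_ ef.
have W'P := zero _ _ _ _ _ _ hP hW' of_ oe ef.
(* [T] is half the all-ones 2 by 2 matrix, the projection onto the graph of [W] over [range P]. *)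
pose T x := rs (1 / 2) (P x + P' x + W x + W' x).
have hT : is_proj ip T.
  apply: (@proj_intro _ (1 / 2 * 4)).
  - move=> a x y; rewrite /T lP lP' lW lW' scale_rsC !scalerDr; hring.
  - move=> x; rewrite hnorm_rs ger0_norm -?mulrA; last by lra.
    apply: ler_wpM2l; first by lra.
    have h1 := ptl_bnd oe oe hP x; have h2 := ptl_bnd of_ of_ hP' x.
    have h3 := ptl_bnd oe of_ hW x; have h4 := ptl_bnd of_ oe hW' x.
    have h5 := hnormD (P x + P' x + W x) (W' x).
    have h6 := hnormD (P x + P' x) (W x); have h7 := hnormD (P x) (P' x).
    by lra.
  - move=> x; rewrite {1}/T (linR lP) (linR lP') (linR lW) (linR lW').
    rewrite !(linD lP, linD lP', linD lW, linD lW').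
    rewrite PP PP' WP P'W PW' W'P' W'W WW' PQ QP WW PW WP' W2 P'W' W'P /T.
    by apply: re_ext => z; rewrite !reE; field.
  - move=> x y; rewrite /T !reE (ptl_adj hP hP) (ptl_adj hP' hP') (ptl_adj hW hW') (ptl_adj hW' hW).
    by ring.
have hQ := compl_op_proj hT; have lT := proj_lin hT.
have Q_T x : range (compl_op T) x <-> T x = 0 by rewrite -(kernel_compl_op _ hT).
have TD s x : T s = T x -> T (x - s) = 0 by rewrite (linB lT) => ->; rewrite subrr.
have half0 x : rs (1 / 2) x = 0 -> x = 0.
  move=> h; apply: re_ext => z; have := congr1 (re^~ z) h; rewrite !reE; lra.
exists (compl_op T); split=> //; split.
(* For [x] in [range P], [P (T x)] is half of [x]. *)
- move=> x /(rangeP (ptl_proj oe hP)) Px /Q_T Tx; apply: half0.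
  rewrite -[RHS](lin0 lP) -Tx /T (linR lP) !(linD lP) PP PQ PW PW' Px.
  have -> : W' x = 0 by rewrite -Px W'P.
  by congr rs; rewrite !addr0.
(* [P x + W' x] lies in [range P] and has the same image under [T] as [x]. *)
- move=> x; exists (P x + W' x), (x - (P x + W' x)); split; last split.
  + by exists (x + W' x); rewrite linD // PW'.
  + apply/Q_T/TD; rewrite /T !(linD lP, linD lP', linD lW, linD lW').
    by rewrite PP PW' QP P'W' WP WW' W'P W2; congr rs; hring.
  + hring.
- move=> x /(rangeP (ptl_proj of_ hP')) Px /Q_T Tx; apply: half0.
  rewrite -[RHS](lin0 lP') -Tx /T (linR lP') !(linD lP') PP' QP P'W P'W' Px.
  have -> : W x = 0 by rewrite -Px WP'.
  by congr rs; rewrite !addr0 add0r.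
- move=> x; exists (P' x + W x), (x - (P' x + W x)); split; last split.
  + by exists (x + W x); rewrite linD // P'W.
  + apply/Q_T/TD; rewrite /T !(linD lP, linD lP', linD lW, linD lW').
    by rewrite PP' P'W PQ PW W'P' W'W WP' WW; congr rs; hring.
  + hring.
Qed.

(** * The component of pairs of infinite rank and corank *)

Lemma compl_self P : is_proj ip P -> is_compl (range P) (range (compl_op P)).
Proof.
move=> hP; split=> [x /(rangeP hP) Px /(kernel_compl_op _ hP) Px0|x].
  by rewrite -Px Px0.
exists (P x), (compl_op P x); split; first by exists x.
by split; [exists x|rewrite /compl_op; hring].
Qed.

Lemma diag_Delta_inf P : proj_inf_inf ip P -> Delta_inf ip (P, P).
Proof.
move=> iP; have hP := iP.1; split=> //; split=> //; split=> //.
exists (compl_op P); split; first exact: compl_op_proj.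
by split; exact: compl_self.
Qed.

Lemma compl_inf_inf P Q : is_proj ip P -> is_proj ip Q ->
  is_compl (range P) (range Q) ->
  (proj_inf_inf ip P <-> proj_inf_inf ip (compl_op Q)).
Proof.
move=> hP hQ hc; have [g [L [g0 g1 L0 hg lip]]] := compl_path hP hQ hc.
rewrite -g0 -g1; apply: (lipschitz_path_inf_inf L0 _ lip); last by rewrite ler01 lexx.
by move=> t; have [] := hg t.
Qed.

Lemma opdist_weak P Q e e' : e <= e' -> opdist_le ip P Q e -> opdist_le ip P Q e'.
Proof.
by move=> h b x; apply: le_trans (b x) _; apply: ler_wpM2r; rewrite ?hnorm_ge0.
Qed.

Lemma common_compl_joined P P' Q : proj_inf_inf ip P -> proj_inf_inf ip P' ->
  is_proj ip Q -> is_compl (range P) (range Q) -> is_compl (range P') (range Q) ->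
  joined (Delta_inf ip) (P, P') (compl_op Q, compl_op Q).
Proof.
move=> iP iP' hQ hc hc'.
have [g [L [g0 g1 L0 hg lip]]] := compl_path iP.1 hQ hc.
have [k [M [k0 k1 M0 hk lip']]] := compl_path iP'.1 hQ hc'.
rewrite -{1}g0 -{1}k0 -{1}g1 -k1.
have LM (s t : R) : L * `|s - t| <= (L + M) * `|s - t| by rewrite ler_wpM2r // lerDl.
have ML (s t : R) : M * `|s - t| <= (L + M) * `|s - t| by rewrite ler_wpM2r // lerDr.
apply: (lipschitz_joined (L := L + M)); first exact: addr_ge0.
- move=> t t01; have [gp gc] := hg t; have [kp kc] := hk t; split.
    by split=> //; split=> //; exists Q.
  split.
    apply/(lipschitz_path_inf_inf L0 (fun t => (hg t).1) lip t01).
    by rewrite g0.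
  apply/(lipschitz_path_inf_inf M0 (fun t => (hk t).1) lip' t01).
  by rewrite k0.
- by move=> s t; exact: (opdist_weak (LM s t) (lip s t)).
- by move=> s t; exact: (opdist_weak (ML s t) (lip' s t)).
Qed.

(** Both diagonal pairs are joined to [(compl_op Q, compl_op Q)], for [Q] a common complement; the
    infinite rank and corank of [P'] are transported the same way. *)
Lemma orthogonal_joined e f P P' : orthon e -> orthon f ->
  (forall j k, ip (e j) (f k) = 0) -> ptl e e P -> ptl f f P' ->
  proj_inf_inf ip P ->
  proj_inf_inf ip P' /\ joined (Delta_inf ip) (P, P) (P', P').
Proof.
move=> oe of_ ef hP hP' iP.
have [Q [hQ hc hc']] := orthogonal_common_compl oe of_ ef hP hP'.
have pP' := ptl_proj of_ hP'.
have iP' : proj_inf_inf ip P'.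
  by apply/(compl_inf_inf pP' hQ hc')/(compl_inf_inf iP.1 hQ hc).
split=> //; apply: (joined_trans (b := (compl_op Q, compl_op Q))).
  exact: common_compl_joined.
by apply: joined_sym; apply: common_compl_joined.
Qed.

(** A single orthonormal sequence takes its even terms in [S] and its odd ones in [T], so [S] and
    [T] may overlap arbitrarily. *)
Lemma interleaved_orthonormal (S T : H -> Prop) :
  (forall (a : C) x y, S x -> S y -> S (a *: x + y)) -> infdim S ->
  (forall (a : C) x y, T x -> T y -> T (a *: x + y)) -> infdim T ->
  exists s t, [/\ orthon s, orthon t, forall j k, ip (s j) (t k) = 0 &
    (forall k, S (s k)) /\ (forall k, T (t k))].
Proof.
move=> subS iS subT iT.
have [l|x hx] := @choose_sequence _ (fun l v =>
  [/\ if odd (size l) then T v else S v, ip v v = 1 & orth_to l v]).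
  by case: (odd _); [exact: (unit_orth l subT iT)|exact: (unit_orth l subS iS)].
have ox : orthon x by apply: orthon_of_prefix => n; have [] := hx n.
exists (fun n => x n.*2), (fun n => x n.*2.+1); split.
- move=> j k; rewrite ox; congr (nat_of_bool _)%:R.
  by apply/eqP/eqP => [/double_inj|->].
- move=> j k; rewrite ox; congr (nat_of_bool _)%:R.
  by apply/eqP/eqP => [[/double_inj]|->].
- move=> j k; rewrite ox; case: eqP => // e.
  by have := congr1 odd e; rewrite /= !odd_double.
- by split=> k; [have [h _ _] := hx k.*2|have [h _ _] := hx k.*2.+1];
  move: h; rewrite size_mkseq /= odd_double.
Qed.

Lemma kernel_sub P : is_proj ip P -> forall (a : C) x y,
  kernel P x -> kernel P y -> kernel P (a *: x + y).
Proof.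
by move=> hP a x y Px Py; rewrite /kernel (proj_lin hP) Px Py scaler0 addr0.
Qed.

Lemma diag_joined P P' : proj_inf_inf ip P -> proj_inf_inf ip P' ->
  joined (Delta_inf ip) (P, P) (P', P').
Proof.
move=> iP iP'; have [hP [rP kP]] := iP; have [hP' [rP' kP']] := iP'.
have [e [oe pe eP]] := proj_ptl hP rP; have [e' [oe' pe' eP']] := proj_ptl hP' rP'.
have [s [t [os ot st [sP tP]]]] :=
  interleaved_orthonormal (kernel_sub hP) kP (kernel_sub hP') kP'.
have [S hS] := ptl_exists os os; have [T hT] := ptl_exists ot ot.
have es j k : ip (e j) (s k) = 0.
  by rewrite -eP (ip_adj (proj_lin hP) (proj_adj hP)) sP ip0r.
have te j k : ip (t j) (e' k) = 0.
  by apply: ip_sym0; rewrite -eP' (ip_adj (proj_lin hP') (proj_adj hP')) tP ip0r.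
have [iS j1] := orthogonal_joined oe os es pe hS iP.
have [iT j2] := orthogonal_joined os ot st hS hT iS.
have [_ j3] := orthogonal_joined ot oe' te hT pe' iT.
exact: joined_trans j1 (joined_trans j2 j3).
Qed.

Lemma Delta_inf_arcwise : arcwise_connected ip (Delta_inf ip).
Proof.
suff main a b : Delta_inf ip a -> Delta_inf ip b -> joined (Delta_inf ip) a b.
  by move=> a b ha hb; exact: main.
case: a b => [P1 P2] [P3 P4].
move=> [[_ [_ [Q [hQ [c1 c2]]]]] [/= i1 i2]] [[_ [_ [Q' [hQ' [c3 c4]]]]] [/= i3 i4]].
apply: joined_trans (common_compl_joined i1 i2 hQ c1 c2) _.
apply: joined_trans (joined_sym (common_compl_joined i3 i4 hQ' c3 c4)).
apply: diag_joined; first by apply/(compl_inf_inf i1.1 hQ c1).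
by apply/(compl_inf_inf i3.1 hQ' c3).
Qed.

(** * Non-emptiness, connectedness and maximality *)

Lemma orthon_infdim (S : H -> Prop) e : orthon e -> (forall k, S (e k)) -> infdim S.
Proof.
move=> oe eS s _; apply: contrapT => /forallNP h; set n := size s in h.
have dec k : exists c : nat -> C, e k = \sum_(i < n) c i *: nth 0 s i.
  have := h (e k); rewrite not_andE => -[/(_ (eS k))//|/existsNP[c /contrapT ->]].
  by exists c.
have [c hc] := choice dec.
(* Expanding [n.+1] of the [e k] on [n] vectors gives a matrix with a nonzero left kernel vector,
   that is, a nontrivial relation between orthonormal vectors. *)
pose A : 'M[C]_(n.+1, n) := \matrix_(k, i) c k i.
have : kermx A != 0.
  rewrite kermx_eq0 /row_free; apply/eqP => r.
  by have := rank_leq_col A; rewrite r ltnn.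
move=> /rowV0Pn[v /sub_kermxP vA]; apply/negP/negPn/eqP/rowP => j.
pose d k := v 0 (inord k).
have sum0 : psum d e n.+1 = 0.
  rewrite /psum; under eq_bigr => k _ do rewrite /d inord_val hc scaler_sumr.
  rewrite exchange_big /= big1 // => i _.
  under eq_bigr => k _ do rewrite scalerA.
  rewrite -scaler_suml.
  have := congr1 (fun M : 'rV[C]_n => M 0 i) vA; rewrite !mxE.
  by under eq_bigr => k _ do rewrite mxE; move=> ->; rewrite scale0r.
have := ip_psum d n.+1 j oe; rewrite sum0 ip0l ltn_ord /d inord_val => <-.
by rewrite mxE.
Qed.

Lemma proj_inf_inf_exists : exists P, proj_inf_inf ip P.
Proof.
have [_ [_ [_ [_ [_ [_ inf]]]]]] := hilb.
have iH : infdim (fun _ : H => True).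
  by move=> s _; have [x hx] := inf s; exists x.
have [|//|s [t [os ot st _]]] := @interleaved_orthonormal _ _ _ iH _ iH; first by [].
have [P hP] := ptl_exists os os; exists P; split; first exact: ptl_proj hP.
split.
  by apply: (orthon_infdim os) => k; exists (s k); rewrite (ptl_fix k os hP).
apply: (orthon_infdim ot) => k; apply: (ptl_kill os hP) => j.
by apply: ip_sym0.
Qed.

Lemma near_pair_sym e p q : near_pair ip e p q -> near_pair ip e q p.
Proof. by move=> [h1 h2]; split; apply: opdist_sym. Qed.

Lemma near_pair_trans e d p q r :
  near_pair ip e p q -> near_pair ip d q r -> near_pair ip (e + d) p r.
Proof.
by move=> [h1 h2] [k1 k2]; split=> x; rewrite mulrDl;
  [apply: le_trans (hnorm_tri (q.1 x) _ _) _|apply: le_trans (hnorm_tri (q.2 x) _ _) _];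
  apply: lerD.
Qed.

Lemma near_pair_refl p : near_pair ip 0 p p.
Proof. by split=> x; rewrite subrr hnorm0 mul0r. Qed.

(** Along an arc from [U] to [V], membership in [U] is locally constant, since inside [A] the open
    set [V] is the complement of [U]. *)
Lemma arcwise_norm_connected A : arcwise_connected ip A -> norm_connected ip A.
Proof.
move=> arc [U [V [oU [oV [cov [[p [Ap Up]] [[q [Aq Vq]] disj]]]]]]].
have [g [g0 g1 gA gc]] := arc p q Ap Aq.
apply: (disj q Aq _ Vq); rewrite -g1.
apply: (@unit_interval_connected (fun t => U (g t))); last by rewrite ler01 lexx.
  move=> t t01; have [Ut|Vt] := cov _ (gA t t01).
    have [e [e0 he]] := oU _ Ut; have [d [d0 hd]] := gc t t01 e e0.
    exists d; split=> // s s01 st; split=> // _.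
    by apply: he; apply: near_pair_sym; apply: hd.
  have [e [e0 he]] := oV _ Vt; have [d [d0 hd]] := gc t t01 e e0.
  exists d; split=> // s s01 st.
  have Vs : V (g s) by apply: he; apply: near_pair_sym; apply: hd.
  by split=> [Us|Ut]; [case: (disj _ (gA s s01) Us Vs)|case: (disj _ (gA t t01) Ut Vt)].
by rewrite g0.
Qed.

Lemma near_Delta_inf e p q : e < 1 -> Delta_inf ip p -> Delta ip q ->
  near_pair ip e p q -> Delta_inf ip q.
Proof.
move=> e1 [_ [i1 i2]] Dq [h1 h2]; split=> //; have [q1 [q2 _]] := Dq.
by split; [apply: near_proj_inf_inf i1 q1 h1 e1|apply: near_proj_inf_inf i2 q2 h2 e1].
Qed.

Lemma Delta_inf_component : is_component ip (Delta_inf ip) (Delta ip).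
Proof.
split.
- by have [P iP] := proj_inf_inf_exists; exists (P, P); apply: diag_Delta_inf.
- by move=> p [].
- exact: arcwise_norm_connected Delta_inf_arcwise.
move=> K cK KD [p [Kp ip_]] q Kq; apply: contrapT => nq; apply: cK.
(* The separating sets are the open neighbourhoods of radius [1] of [Delta_inf] and of the rest of
   [Delta]. *)
pose ball (B : _ -> Prop) (x : (H -> H) * (H -> H)) :=
  exists y e, [/\ B y, e < 1 & near_pair ip e y x].
have ball_open B : norm_open ip (ball B).
  move=> x [y [e [By e1 yx]]]; exists ((1 - e) / 2); split; first by lra.
  move=> z xz; exists y, (e + (1 - e) / 2); split=> //; first by lra.
  exact: near_pair_trans yx xz.
have ball_self (B : _ -> Prop) x : B x -> ball B x.
  by move=> Bx; exists x, 0; split=> //; exact: near_pair_refl.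
exists (ball (Delta_inf ip)), (ball (fun x => Delta ip x /\ ~ Delta_inf ip x)).
do ![split=> //].
- move=> x Kx; have [ix|nx] := pselect (Delta_inf ip x); [left|right]; apply: ball_self => //.
  by split=> //; apply: KD.
- by exists p; split=> //; apply: ball_self.
- by exists q; split=> //; apply: ball_self; split=> //; apply: KD.
(* The point [x] of [K] is in [Delta], so nearness carries [Delta_inf] from [y] to [x] and then to
   [z]. *)
move=> x Kx [y [e [iy e1 yx]]] [z [e' [[Dz nz] e1' zx]]].
apply: nz; apply: (near_Delta_inf e1' _ Dz (near_pair_sym zx)).
exact: near_Delta_inf e1 iy (KD x Kx) yx.
Qed.

End HilbertGeometry.

Theorem mainTheorem2 (R : realType) (H : lmodType (R[i])) (ip : H -> H -> R[i]) :
  sep_inf_hilbert ip ->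
  arcwise_connected ip (Delta_inf ip) /\ is_component ip (Delta_inf ip) (Delta ip).
Proof.
by move=> hilb; split; [exact: Delta_inf_arcwise|exact: Delta_inf_component].
Qed.
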